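(* Let $q$ be a real number with $0<q<1$, let $n>1$ be an integer and let $\phi\in(0,2\pi)$. Let $\pi_{\phi,+}$ and $\pi_{\phi,-}$ be the $*$-representations of $\mathcal A^{2n}$ by bounded operators on Hilbert spaces $V_{\phi,\pm}$ described in the context, identified via their orthonormal bases. Set $\pi_\phi=\pi_{\phi,+}\oplus\pi_{\phi,-}$ on $\mathcal H_\phi=V_{\phi,+}\oplus V_{\phi,-}$ and $$F=\begin{pmatrix}0&1\\1&0\end{pmatrix},\qquad\gamma=\begin{pmatrix}1&0\\0&-1\end{pmatrix}.$$ Then $(\mathcal H_\phi,F,\gamma)$ is an even 1-summable Fredholm module over $\mathcal A^{2n}$; in particular $[F,\pi_\phi(x)]$ is a trace-class operator for every $x\in\mathcal A^{2n}$.
   Context: $\mathcal A^{2n}$ is the unital complex $*$-algebra generated by $\zeta_0,\dots,\zeta_n$ and a central unitary $\xi$ subject to $$\zeta_i\zeta_j=q\zeta_j\zeta_i\ (i<j),\quad\zeta_i\zeta_j^*=q\zeta_j^*\zeta_i\ (i\ne j),\quad\zeta_i\zeta_i^*=\zeta_i^*\zeta_i+(q^{-2}-1)\sum_{m=i+1}^n\zeta_m\zeta_m^*,\quad\sum_{m=0}^n\zeta_m\zeta_m^*=1,\quad\zeta_n^*=\zeta_n\xi.$$ (It is isomorphic to the $\mathcal O(U(1))$-prolongation $\mathcal O(S^{2n}_q)\square_{\mathcal O(\mathbb Z_2)}\mathcal O(U(1))$ of the coordinate algebra of the even quantum sphere.) $V_{\phi,\pm}$ is the Hilbert space with orthonormal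 basis $|k_0,k_1,\dots,k_{n-1}\rangle$, $k_i=0,1,2,\dots$, and $\pi_{\phi,\pm}$ is the representation given by $$\pi_{\phi,\pm}(\zeta_n)|k_0,\dots,k_{n-1}\rangle=\pm e^{i\phi}q^{k_0+\dots+k_{n-1}+n}|k_0,\dots,k_{n-1}\rangle,$$ $$\pi_{\phi,\pm}(\zeta_l)|k_0,\dots,k_{n-1}\rangle=(1-q^{2k_l})^{1/2}q^{k_0+\dots+k_{l-1}+l}|k_0,\dots,k_l-1,\dots,k_{n-1}\rangle\quad(l<n),$$ $$\pi_{\phi,\pm}(\xi)|k_0,\dots,k_{n-1}\rangle=e^{-2i\phi}|k_0,\dots,k_{n-1}\rangle,$$ (the second expression is $0$ when $k_l=0$). An even Fredholm module over a $*$-algebra $\mathcal A$ is a $*$-representation $\pi$ of $\mathcal A$ on a Hilbert space $\mathcal H$ with operators $F,\gamma$ such that $F=F^*$, $F^2=1$, $\gamma=\gamma^*$, $\gamma^2=1$, $F\gamma=-\gamma F$, $\gamma\pi(x)=\pi(x)\gamma$ and $[F,\pi(x)]$ is compact for all $x\in\mathcal A$. It is 1-summable if $[F,\pi(x)]$ is trace class for all $x\in\mathcal A$. *)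

(* Defs.v *)
From HB Require Import structures.
From mathcomp Require Import all_boot all_order all_algebra.
From mathcomp Require Import generic_quotient.
From mathcomp Require Import complex.
From mathcomp Require Import all_classical all_reals.
From mathcomp Require Import topology normedtype sequences esum exp trigo.
From mathcomp Require Import ring.

Set Implicit Arguments.
Unset Strict Implicit.
Unset Printing Implicit Defensive.

Import Order.TTheory GRing.Theory Num.Theory.
Import numFieldNormedType.Exports.

Local Open Scope classical_set_scope.
Local Open Scope complex_scope.
Local Open Scope ring_scope.

HB.mixin Record Algebra_isStarAlgebra (R : realType) A
    of GRing.Algebra R[i] A := {
  star : A -> A;
  starD : forall x y, star (x + y) = star x + star y;
  starZ : forall (a : R[i]) x, star (a *: x) = a^* *: star x;
  starM : forall x y, star (x * y) = star y * star x;
  starK : involutive star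
}.

#[short(type="starAlgType")]
HB.structure Definition StarAlgebra (R : realType) :=
  {A of GRing.Algebra R[i] A & Algebra_isStarAlgebra R A}.

(* The inner product is linear in its first argument. Definiteness follows   *)
(* from dot_norm and the definiteness of the norm.                           *)
HB.mixin Record CompleteNormedModule_isHilbert (R : realType) H
    of CompleteNormedModule R[i] H := {
  dot : H -> H -> R[i];
  dot_linear : forall v, scalar (dot ^~ v);
  dot_sym : forall u v, dot u v = (dot v u)^*;
  dot_norm : forall u, dot u u = `|u| ^+ 2
}.

#[short(type="hilbertType")]
HB.structure Definition Hilbert (R : realType) :=
  {H of CompleteNormedModule R[i] H & CompleteNormedModule_isHilbert R H}.

Section DotTheory.
Variables (R : realType) (H : hilbertType R).
Implicit Types u v w : H.

Lemma dotDl u v w : dot (u + v) w = dot u w + dot v w.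
Proof. by have := dot_linear w 1 u v; rewrite scale1r mul1r. Qed.

Lemma dotDr u v w : dot w (u + v) = dot w u + dot w v.
Proof. by rewrite dot_sym dotDl rmorphD /= -!dot_sym. Qed.

Lemma dot0l w : dot 0 w = 0.
Proof. by apply: (addrI (dot 0 w)); rewrite -dotDl !addr0. Qed.

Lemma dotZl (a : R[i]) u w : dot (a *: u) w = a * dot u w.
Proof. by have := dot_linear w a u 0; rewrite dot0l !addr0. Qed.

Lemma dotZr (a : R[i]) u w : dot w (a *: u) = a^* * dot w u.
Proof. by rewrite dot_sym dotZl rmorphM /= -dot_sym. Qed.

End DotTheory.

(* The alias keeps the product from inheriting the sup norm of U * V.        *)
Definition direct_sum (R : realType) (U V : hilbertType R) : Type :=
  (U * V)%type.

Section DirectSum.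
Variables (R : realType) (U V : hilbertType R).
Local Notation W := (direct_sum U V).
Implicit Types w x y : W.

HB.instance Definition _ := GRing.Lmodule.copy W (U * V)%type.

Definition direct_sum_norm w : R[i] :=
  sqrtC (`|w.1| ^+ 2 + `|w.2| ^+ 2).

Lemma ler_direct_sum_normD x y :
  direct_sum_norm (x + y) <= direct_sum_norm x + direct_sum_norm y.
Proof.
have n0 (z : W) : 0 <= `|z.1| ^+ 2 + `|z.2| ^+ 2 by rewrite addr_ge0 ?exprn_ge0.
have s0 (z : W) : 0 <= direct_sum_norm z by rewrite sqrtC_ge0.
rewrite -(@ler_pXn2r _ 2)// ?nnegrE ?s0 ?addr_ge0 ?s0//.
rewrite sqrrD !sqrtCK -sqrtCM ?nnegrE ?n0//.
have le1 : `|(x + y).1| ^+ 2 + `|(x + y).2| ^+ 2 <=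
    (`|x.1| + `|y.1|) ^+ 2 + (`|x.2| + `|y.2|) ^+ 2.
  by apply: lerD; rewrite ler_pXn2r ?nnegrE ?addr_ge0// ler_normD.
apply: (le_trans le1); rewrite !sqrrD.
set a := `|x.1|; set b := `|y.1|; set c := `|x.2|; set d := `|y.2|.
have [a0 b0 c0 d0] : [/\ 0 <= a, 0 <= b, 0 <= c & 0 <= d] by rewrite /a /b /c /d.
have -> : a ^+ 2 + a * b *+ 2 + b ^+ 2 + (c ^+ 2 + c * d *+ 2 + d ^+ 2) =
    (a ^+ 2 + c ^+ 2) + (a * b + c * d) *+ 2 + (b ^+ 2 + d ^+ 2).
  by ring.
rewrite lerD2r lerD2l lerMn2r/=.
rewrite -(@ler_pXn2r _ 2)// ?nnegrE ?sqrtC_ge0 ?addr_ge0 ?mulr_ge0 ?addr_ge0 ?exprn_ge0//.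
rewrite sqrtCK -subr_ge0.
have -> : (a ^+ 2 + c ^+ 2) * (b ^+ 2 + d ^+ 2) - (a * b + c * d) ^+ 2 =
    (a * d - c * b) ^+ 2.
  by rewrite !expr2; ring.
by rewrite -realEsqr rpredB// ger0_real// mulr_ge0.
Qed.

Lemma direct_sum_normZ (a : R[i]) w :
  direct_sum_norm (a *: w) = `|a| * direct_sum_norm w.
Proof.
rewrite /direct_sum_norm /= !normrZ !exprMn -mulrDr sqrtCM ?nnegrE;
  rewrite ?addr_ge0 ?exprn_ge0//.
by rewrite sqrCK.
Qed.

Lemma direct_sum_norm_eq0 w : direct_sum_norm w = 0 -> w = 0.
Proof.
move/eqP; rewrite sqrtC_eq0 paddr_eq0 ?exprn_ge0// !expf_eq0 /= !normr_eq0.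
by case: w => u v /= /andP[/eqP -> /eqP ->].
Qed.

HB.instance Definition _ := Lmodule_isNormed.Build R[i] W
  ler_direct_sum_normD direct_sum_normZ direct_sum_norm_eq0.

Lemma direct_sum_normE w : `|w| = sqrtC (`|w.1| ^+ 2 + `|w.2| ^+ 2).
Proof. by []. Qed.

Lemma direct_sum_sqr_norm w : `|w| ^+ 2 = `|w.1| ^+ 2 + `|w.2| ^+ 2.
Proof. by rewrite direct_sum_normE sqrtCK. Qed.

Lemma direct_sum_norm1_le w : `|w.1| <= `|w|.
Proof.
rewrite -(@ler_pXn2r _ 2)// ?nnegrE// direct_sum_sqr_norm.
by rewrite lerDl exprn_ge0.
Qed.

Lemma direct_sum_norm2_le w : `|w.2| <= `|w|.
Proof.
rewrite -(@ler_pXn2r _ 2)// ?nnegrE// direct_sum_sqr_norm.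
by rewrite lerDr exprn_ge0.
Qed.

Lemma direct_sum_norm_leD w : `|w| <= `|w.1| + `|w.2|.
Proof.
rewrite -(@ler_pXn2r _ 2)// ?nnegrE ?addr_ge0// direct_sum_sqr_norm sqrrD.
by rewrite addrAC lerDl mulrn_wge0 ?mulr_ge0.
Qed.

Lemma direct_sum_complete (F : set_system W) :
  ProperFilter F -> cauchy F -> cvg F.
Proof.
move=> FF Fc.
have Fball (e : R[i]) : 0 < e -> exists x : W, F (ball x e).
  by move=> e0; have /cauchyP Fe := Fc; apply: Fe.
have c1 : cvg ((fun w : W => w.1) @ F).
  apply: cauchy_cvg; apply/cauchyP => e e0.
  have [x Fx] := Fball e e0; exists x.1.
  suff : F [set w : W | ball x.1 e w.1] by [].
  apply: filterS Fx => w; rewrite /= -!ball_normE /ball_ /=.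
  exact/le_lt_trans/(direct_sum_norm1_le (x - w)).
have c2 : cvg ((fun w : W => w.2) @ F).
  apply: cauchy_cvg; apply/cauchyP => e e0.
  have [x Fx] := Fball e e0; exists x.2.
  suff : F [set w : W | ball x.2 e w.2] by [].
  apply: filterS Fx => w; rewrite /= -!ball_normE /ball_ /=.
  exact/le_lt_trans/(direct_sum_norm2_le (x - w)).
have /cvg_ex[l1 Fl1] := c1; have /cvg_ex[l2 Fl2] := c2.
apply/cvg_ex; exists ((l1, l2) : W).
apply/(@cvgrPdist_lt _ W _ F _ id) => e e0.
have e20 : 0 < e / 2 by rewrite divr_gt0.
have /cvgrPdist_lt/(_ _ e20) H1 := Fl1.
have /cvgrPdist_lt/(_ _ e20) H2 := Fl2.
near=> w.
apply: (le_lt_trans (direct_sum_norm_leD _)).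
rewrite [e]splitr; apply: ltrD; near: w; [exact: H1|exact: H2].
Unshelve. all: by end_near. Qed.

HB.instance Definition _ := Uniform_isComplete.Build W direct_sum_complete.

Definition direct_sum_dot (x y : W) : R[i] := dot x.1 y.1 + dot x.2 y.2.

Lemma direct_sum_dot_linear y : scalar (direct_sum_dot ^~ y).
Proof.
by move=> a x z; rewrite /direct_sum_dot /= !dotDl !dotZl mulrDr addrACA.
Qed.

Lemma direct_sum_dot_sym x y : direct_sum_dot x y = (direct_sum_dot y x)^*.
Proof. by rewrite /direct_sum_dot rmorphD /= -!dot_sym. Qed.

Lemma direct_sum_dot_norm x : direct_sum_dot x x = `|x| ^+ 2.
Proof. by rewrite /direct_sum_dot !dot_norm direct_sum_sqr_norm. Qed.

HB.instance Definition _ := CompleteNormedModule_isHilbert.Build R W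
  direct_sum_dot_linear direct_sum_dot_sym direct_sum_dot_norm.

End DirectSum.

Section Operators.
Variables (R : realType) (H : hilbertType R).
Implicit Types S T : H -> H.

Definition bounded_operator T :=
  linear T /\ exists M : R[i], forall v, `|T v| <= M * `|v|.

Definition adjoint_to T T' := forall u v, dot (T u) v = dot u (T' v).

Definition self_adjoint T := adjoint_to T T.

Definition commutator S T : H -> H := fun v => S (T v) - T (S v).

Definition compact_operator T :=
  linear T /\ precompact (T @` [set v | `|v| <= 1]).

Definition orthonormal_basis (I : choiceType) (e : I -> H) :=
  (forall i j, dot (e i) (e j) = (i == j)%:R) /\
  closure [set v | exists (s : seq I) (c : I -> R[i]),
                     v = \sum_(i <- s) c i *: e i] = [set: H].

Definition positive_operator S :=
  bounded_operator S /\ forall v, 0 <= dot (S v) v.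

(* S = |T|, the unique positive square root of T^* T.                        *)
Definition absolute_value T S :=
  positive_operator S /\
  exists2 T', adjoint_to T T' & forall v, S (S v) = T' (T v).

(* The trace of a positive operator, as an extended real; its value does not *)
(* depend on the orthonormal basis e.                                        *)
Definition positive_trace (I : choiceType) (e : I -> H) S : \bar R :=
  (\esum_(i in [set: I]) (complex.Re (dot (S (e i)) (e i)))%:E)%E.

Definition trace_class T :=
  bounded_operator T /\
  exists2 S, absolute_value T S &
  exists I : choiceType, exists2 e : I -> H,
    orthonormal_basis e & (positive_trace e S < +oo)%E.

End Operators.

Section FredholmModule.
Variables (R : realType) (A : starAlgType R) (H : hilbertType R).

Definition star_representation (rho : A -> H -> H) :=
  [/\ forall x, bounded_operator (rho x),
      forall (a : R[i]) x y v, rho (a *: x + y) v = a *: rho x v + rho y v,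
      forall v, rho 1 v = v,
      forall x y v, rho (x * y) v = rho x (rho y v)
    & forall x, adjoint_to (rho x) (rho (star x))].

Definition even_fredholm_module (rho : A -> H -> H) (F g : H -> H) :=
  [/\ star_representation rho,
      [/\ bounded_operator F, self_adjoint F & forall v, F (F v) = v],
      [/\ bounded_operator g, self_adjoint g & forall v, g (g v) = v],
      forall v, F (g v) = - g (F v)
    & forall x, (forall v, g (rho x v) = rho x (g v)) /\
                compact_operator (commutator F (rho x))].

Definition one_summable (rho : A -> H -> H) (F : H -> H) :=
  forall x, trace_class (commutator F (rho x)).

End FredholmModule.

(* The *-algebra A^{2n} is the algebra of formal *-expressions in the        *)
(* generators, modulo the smallest congruence containing the axioms of       *)
(* unital complex *-algebras and the defining relations.                     *)
Inductive A2n_term (R : realType) (n : nat) : Type :=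
| Tzeta of 'I_n.+1
| Txi
| Tzero
| Tone
| Tadd of A2n_term R n & A2n_term R n
| Topp of A2n_term R n
| Tmul of A2n_term R n & A2n_term R n
| Tscale of R[i] & A2n_term R n
| Tstar of A2n_term R n.

Arguments Tzeta {R n} i.
Arguments Txi {R n}.
Arguments Tzero {R n}.
Arguments Tone {R n}.

HB.instance Definition _ (R : realType) (n : nat) :=
  gen_eqMixin (A2n_term R n).
HB.instance Definition _ (R : realType) (n : nat) :=
  gen_choiceMixin (A2n_term R n).

Section A2n.
Variables (R : realType) (q : R) (n : nat).
Local Notation term := (A2n_term R n).
Local Open Scope quotient_scope.
Local Open Scope ring_scope.
Local Notation "x ⊕ y" := (Tadd x y) (at level 50, left associativity).
Local Notation "x ⊗ y" := (Tmul x y) (at level 40, left associativity).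
Local Notation "a ⊙ x" := (Tscale a x) (at level 40).
Local Notation "x ⁎" := (Tstar x) (at level 1, left associativity, format "x ⁎").
Local Notation ζ := (@Tzeta R n).
Local Notation ξ := (@Txi R n).
Reserved Notation "x ≈ y" (at level 70).

Inductive A2n_congr : term -> term -> Prop :=
| congr_refl x : x ≈ x
| congr_sym x y : x ≈ y -> y ≈ x
| congr_trans x y z : x ≈ y -> y ≈ z -> x ≈ z
| congr_add x x' y y' : x ≈ x' -> y ≈ y' -> x ⊕ y ≈ x' ⊕ y'
| congr_opp x x' : x ≈ x' -> Topp x ≈ Topp x'
| congr_mul x x' y y' : x ≈ x' -> y ≈ y' -> x ⊗ y ≈ x' ⊗ y'
| congr_scale a x x' : x ≈ x' -> a ⊙ x ≈ a ⊙ x'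
| congr_star x x' : x ≈ x' -> x⁎ ≈ x'⁎
| ax_addA x y z : x ⊕ (y ⊕ z) ≈ x ⊕ y ⊕ z
| ax_addC x y : x ⊕ y ≈ y ⊕ x
| ax_add0 x : Tzero ⊕ x ≈ x
| ax_addN x : Topp x ⊕ x ≈ Tzero
| ax_mulA x y z : x ⊗ (y ⊗ z) ≈ x ⊗ y ⊗ z
| ax_mul1l x : Tone ⊗ x ≈ x
| ax_mul1r x : x ⊗ Tone ≈ x
| ax_mulDl x y z : (x ⊕ y) ⊗ z ≈ (x ⊗ z) ⊕ (y ⊗ z)
| ax_mulDr x y z : x ⊗ (y ⊕ z) ≈ (x ⊗ y) ⊕ (x ⊗ z)
| ax_scaleA a b x : a ⊙ (b ⊙ x) ≈ (a * b) ⊙ x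
| ax_scale1 x : 1 ⊙ x ≈ x
| ax_scaleDr a x y : a ⊙ (x ⊕ y) ≈ (a ⊙ x) ⊕ (a ⊙ y)
| ax_scaleDl a b x : (a + b) ⊙ x ≈ (a ⊙ x) ⊕ (b ⊙ x)
| ax_scaleAl a x y : a ⊙ (x ⊗ y) ≈ (a ⊙ x) ⊗ y
| ax_scaleAr a x y : a ⊙ (x ⊗ y) ≈ x ⊗ (a ⊙ y)
| ax_starD x y : (x ⊕ y)⁎ ≈ x⁎ ⊕ y⁎
| ax_starZ a x : (a ⊙ x)⁎ ≈ a^* ⊙ x⁎
| ax_starM x y : (x ⊗ y)⁎ ≈ y⁎ ⊗ x⁎
| ax_starK x : x⁎⁎ ≈ x
| rel_xi_central x : ξ ⊗ x ≈ x ⊗ ξ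
| rel_xi_unitaryl : ξ⁎ ⊗ ξ ≈ Tone
| rel_xi_unitaryr : ξ ⊗ ξ⁎ ≈ Tone
| rel_zeta_zeta (i j : 'I_n.+1) :
    (i < j)%N -> ζ i ⊗ ζ j ≈ q%:C ⊙ (ζ j ⊗ ζ i)
| rel_zeta_star (i j : 'I_n.+1) :
    i != j -> ζ i ⊗ (ζ j)⁎ ≈ q%:C ⊙ ((ζ j)⁎ ⊗ ζ i)
| rel_zeta_normal (i : 'I_n.+1) :
    ζ i ⊗ (ζ i)⁎ ≈ ((ζ i)⁎ ⊗ ζ i) ⊕
      ((q^-2 - 1)%:C ⊙
         \big[@Tadd R n/Tzero]_(m < n.+1 | (i < m)%N) (ζ m ⊗ (ζ m)⁎))
| rel_sphere : \big[@Tadd R n/Tzero]_(m < n.+1) (ζ m ⊗ (ζ m)⁎) ≈ Tone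
| rel_zeta_last : (ζ ord_max)⁎ ≈ ζ ord_max ⊗ ξ
where "x ≈ y" := (A2n_congr x y).

Definition A2n_congrb (x y : term) : bool := `[< x ≈ y >].

Lemma A2n_congrb_refl : reflexive A2n_congrb.
Proof. by move=> x; apply/asboolP; exact: congr_refl. Qed.

Lemma A2n_congrb_sym : symmetric A2n_congrb.
Proof. by move=> x y; apply/asboolP/asboolP => ?; exact: congr_sym. Qed.

Lemma A2n_congrb_trans : transitive A2n_congrb.
Proof.
by move=> y x z /asboolP xy /asboolP yz; apply/asboolP/(congr_trans xy yz).
Qed.

Canonical A2n_equiv :=
  EquivRel A2n_congrb A2n_congrb_refl A2n_congrb_sym A2n_congrb_trans.

Definition A2n := {eq_quot A2n_equiv}.
HB.instance Definition _ := Choice.on A2n.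
HB.instance Definition _ := EqQuotient.on A2n.

Local Notation "[ x ]q" := (\pi_A2n x) (at level 0, format "[ x ]q").

Lemma A2n_eqP (x y : term) : [x]q = [y]q <-> x ≈ y.
Proof.
split=> [/eqP|xy]; first by rewrite piE => /asboolP.
by apply/eqP; rewrite piE; exact/asboolP.
Qed.

Lemma A2n_reprK (x : term) : repr [x]q ≈ x.
Proof. by apply/A2n_eqP; rewrite reprK. Qed.

Definition A2n_add := lift_op2 A2n (@Tadd R n).
Definition A2n_opp := lift_op1 A2n (@Topp R n).
Definition A2n_mul := lift_op2 A2n (@Tmul R n).
Definition A2n_scale (a : R[i]) := lift_op1 A2n (Tscale a).
Definition A2n_star := lift_op1 A2n (@Tstar R n).

Lemma A2n_addE x y : A2n_add [x]q [y]q = [x ⊕ y]q.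
Proof. by unlock A2n_add; apply/A2n_eqP/congr_add; exact: A2n_reprK. Qed.
Lemma A2n_oppE x : A2n_opp [x]q = [Topp x]q.
Proof. by unlock A2n_opp; apply/A2n_eqP/congr_opp; exact: A2n_reprK. Qed.
Lemma A2n_mulE x y : A2n_mul [x]q [y]q = [x ⊗ y]q.
Proof. by unlock A2n_mul; apply/A2n_eqP/congr_mul; exact: A2n_reprK. Qed.
Lemma A2n_scaleE a x : A2n_scale a [x]q = [a ⊙ x]q.
Proof. by unlock A2n_scale; apply/A2n_eqP/congr_scale; exact: A2n_reprK. Qed.
Lemma A2n_starE x : A2n_star [x]q = [x⁎]q.
Proof. by unlock A2n_star; apply/A2n_eqP/congr_star; exact: A2n_reprK. Qed.

Let opE := (A2n_addE, A2n_oppE, A2n_mulE, A2n_scaleE, A2n_starE).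

Lemma A2n_addA : associative A2n_add.
Proof.
by elim/quotW=> x; elim/quotW=> y; elim/quotW=> z;
   rewrite !opE; apply/A2n_eqP; exact: ax_addA.
Qed.
Lemma A2n_addC : commutative A2n_add.
Proof.
by elim/quotW=> x; elim/quotW=> y; rewrite !opE; apply/A2n_eqP; exact: ax_addC.
Qed.
Lemma A2n_add0 : left_id [Tzero]q A2n_add.
Proof. by elim/quotW=> x; rewrite !opE; apply/A2n_eqP; exact: ax_add0. Qed.
Lemma A2n_addN : left_inverse [Tzero]q A2n_opp A2n_add.
Proof. by elim/quotW=> x; rewrite !opE; apply/A2n_eqP; exact: ax_addN. Qed.

HB.instance Definition _ :=
  GRing.isZmodule.Build A2n A2n_addA A2n_addC A2n_add0 A2n_addN.

Lemma A2n_mulA : associative A2n_mul.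
Proof.
by elim/quotW=> x; elim/quotW=> y; elim/quotW=> z;
   rewrite !opE; apply/A2n_eqP; exact: ax_mulA.
Qed.
Lemma A2n_mul1l : left_id [Tone]q A2n_mul.
Proof. by elim/quotW=> x; rewrite !opE; apply/A2n_eqP; exact: ax_mul1l. Qed.
Lemma A2n_mul1r : right_id [Tone]q A2n_mul.
Proof. by elim/quotW=> x; rewrite !opE; apply/A2n_eqP; exact: ax_mul1r. Qed.
Lemma A2n_mulDl : left_distributive A2n_mul +%R.
Proof.
by elim/quotW=> x; elim/quotW=> y; elim/quotW=> z;
   rewrite /GRing.add /= !opE; apply/A2n_eqP; exact: ax_mulDl.
Qed.
Lemma A2n_mulDr : right_distributive A2n_mul +%R.
Proof.
by elim/quotW=> x; elim/quotW=> y; elim/quotW=> z;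
   rewrite /GRing.add /= !opE; apply/A2n_eqP; exact: ax_mulDr.
Qed.

(* A character of A2n, which shows 1 <> 0: zeta_0 and xi go to 1, the other  *)
(* generators to 0.                                                          *)
Fixpoint A2n_char (x : term) : R[i] :=
  match x with
  | Tzeta i => (val i == 0)%:R
  | Txi => 1
  | Tzero => 0
  | Tone => 1
  | Tadd x y => A2n_char x + A2n_char y
  | Topp x => - A2n_char x
  | Tmul x y => A2n_char x * A2n_char y
  | Tscale a x => a * A2n_char x
  | Tstar x => (A2n_char x)^*
  end.

Lemma A2n_char_sum (P : pred 'I_n.+1) (f : 'I_n.+1 -> term) :
  A2n_char (\big[@Tadd R n/Tzero]_(m < n.+1 | P m) f m) =
  \sum_(m < n.+1 | P m) A2n_char (f m).
Proof. exact: (big_morph A2n_char). Qed.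

Lemma A2n_char_congr (x y : term) : x ≈ y -> A2n_char x = A2n_char y.
Proof.
elim=> {x y} //=; do ?by move=> *; congruence.
- by move=> x y z; rewrite addrA.
- by move=> x y; rewrite addrC.
- by move=> x; rewrite add0r.
- by move=> x; rewrite addNr.
- by move=> x y z; rewrite mulrA.
- by move=> x; rewrite mul1r.
- by move=> x; rewrite mulr1.
- by move=> x y z; rewrite mulrDl.
- by move=> x y z; rewrite mulrDr.
- by move=> a b x; rewrite mulrA.
- by move=> x; rewrite mul1r.
- by move=> a x y; rewrite mulrDr.
- by move=> a b x; rewrite mulrDl.
- by move=> a x y; rewrite mulrA.
- by move=> a x y; rewrite mulrCA.
- by move=> x y; rewrite rmorphD.
- by move=> a x; rewrite rmorphM.
- by move=> x y; rewrite rmorphM mulrC.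
- by move=> x; rewrite conjCK.
- by move=> x; rewrite mulrC.
- by rewrite conjC1 mulr1.
- by rewrite conjC1 mulr1.
- by move=> i j ij; rewrite (gtn_eqF (leq_trans _ ij)) ?mulr0 ?mul0r ?mulr0.
- move=> i j; rewrite -val_eqE conjC_nat /=.
  by case: (val i) => [|?]; case: (val j) => [|?] //=;
     rewrite ?(mulr0, mul0r).
- move=> i; rewrite A2n_char_sum big1 => [|m im] /=.
    by rewrite mulr0 addr0 mulrC.
  by rewrite (gtn_eqF (leq_trans _ im))// mul0r.
- rewrite A2n_char_sum big_ord_recl /= conjC_nat mulr1 big1 ?addr0// => m _ /=.
  by rewrite mul0r.
- by rewrite conjC_nat mulr1.
Qed.

Lemma A2n_oner_neq0 : [Tone]q != 0 :> A2n.
Proof.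
apply/eqP => /A2n_eqP /A2n_char_congr /= /eqP.
by rewrite oner_eq0.
Qed.

HB.instance Definition _ := GRing.Zmodule_isNzRing.Build A2n
  A2n_mulA A2n_mul1l A2n_mul1r A2n_mulDl A2n_mulDr A2n_oner_neq0.

Lemma A2n_scaleA a b x : A2n_scale a (A2n_scale b x) = A2n_scale (a * b) x.
Proof.
by elim/quotW: x => x; rewrite !opE; apply/A2n_eqP; exact: ax_scaleA.
Qed.
Lemma A2n_scale1 : left_id 1 A2n_scale.
Proof. by elim/quotW=> x; rewrite !opE; apply/A2n_eqP; exact: ax_scale1. Qed.
Lemma A2n_scaleDr : right_distributive A2n_scale +%R.
Proof.
by move=> a; elim/quotW=> x; elim/quotW=> y;
   rewrite /GRing.add /= !opE; apply/A2n_eqP; exact: ax_scaleDr.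
Qed.
Lemma A2n_scaleDl x : {morph A2n_scale^~ x : a b / a + b}.
Proof.
elim/quotW: x => x a b.
by rewrite [RHS]/GRing.add /= !opE; apply/A2n_eqP; exact: ax_scaleDl.
Qed.

HB.instance Definition _ := GRing.Zmodule_isLmodule.Build R[i] A2n
  A2n_scaleA A2n_scale1 A2n_scaleDr A2n_scaleDl.

Lemma A2n_scaleAl (a : R[i]) (x y : A2n) : a *: (x * y) = a *: x * y.
Proof.
elim/quotW: x => x; elim/quotW: y => y.
by rewrite /GRing.scale /GRing.mul /= !opE; apply/A2n_eqP; exact: ax_scaleAl.
Qed.
Lemma A2n_scaleAr (a : R[i]) (x y : A2n) : a *: (x * y) = x * (a *: y).
Proof.
elim/quotW: x => x; elim/quotW: y => y.
by rewrite /GRing.scale /GRing.mul /= !opE; apply/A2n_eqP; exact: ax_scaleAr.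
Qed.

HB.instance Definition _ := GRing.Lmodule_isLalgebra.Build R[i] A2n A2n_scaleAl.
HB.instance Definition _ := GRing.Lalgebra_isAlgebra.Build R[i] A2n A2n_scaleAr.

Lemma A2n_starD (x y : A2n) : A2n_star (x + y) = A2n_star x + A2n_star y.
Proof.
elim/quotW: x => x; elim/quotW: y => y.
by rewrite /GRing.add /= !opE; apply/A2n_eqP; exact: ax_starD.
Qed.
Lemma A2n_starZ (a : R[i]) (x : A2n) : A2n_star (a *: x) = a^* *: A2n_star x.
Proof.
elim/quotW: x => x.
by rewrite /GRing.scale /= !opE; apply/A2n_eqP; exact: ax_starZ.
Qed.
Lemma A2n_starM (x y : A2n) : A2n_star (x * y) = A2n_star y * A2n_star x.
Proof.
elim/quotW: x => x; elim/quotW: y => y.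
by rewrite /GRing.mul /= !opE; apply/A2n_eqP; exact: ax_starM.
Qed.
Lemma A2n_starK : involutive A2n_star.
Proof. by elim/quotW=> x; rewrite !opE; apply/A2n_eqP; exact: ax_starK. Qed.

HB.instance Definition _ := Algebra_isStarAlgebra.Build R A2n
  A2n_starD A2n_starZ A2n_starM A2n_starK.

Definition zeta (i : 'I_n.+1) : A2n := [Tzeta i]q.
Definition xi : A2n := [Txi]q.

End A2n.

Section PiPhi.
Variables (R : realType) (q : R) (n : nat) (phi : R).
Local Notation index := {ffun 'I_n -> nat}.

Definition lower (l : 'I_n) (k : index) : index :=
  [ffun i => if i == l then (k i).-1 else k i].

Definition expi (t : R) : R[i] := cos t +i* sin t.

Section OnBasis.
Variables (V : hilbertType R) (e : index -> V).

(* pi_{phi,+} for s = false, pi_{phi,-} for s = true. The junk value of      *)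
(* lower l k when k l = 0 is harmless: its coefficient (1 - q^0)^{1/2} is 0. *)
Definition is_pi_phi (s : bool) (rho : A2n q n -> V -> V) :=
  [/\ star_representation rho,
      forall k : index, rho (zeta q ord_max) (e k) =
        ((-1) ^+ s * expi phi * (q ^+ (\sum_(i < n) k i + n))%:C) *: e k,
      forall (l : 'I_n) (k : index), rho (zeta q (widen_ord (leqnSn n) l)) (e k) =
        (Num.sqrt (1 - q ^+ (2 * k l)) *
         q ^+ (\sum_(i < n | (i < l)%N) k i + l))%:C *: e (lower l k)
    & forall k : index, rho (xi q n) (e k) = expi (- (2 * phi)) *: e k].

End OnBasis.
End PiPhi.

Section FredholmData.
Variables (R : realType) (A : Type) (V : hilbertType R).
Implicit Type w : direct_sum V V.

Definition direct_sum_rep (rho_p rho_m : A -> V -> V) (x : A) w :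
  direct_sum V V := (rho_p x w.1, rho_m x w.2).

Definition flip_op w : direct_sum V V := (w.2, w.1).

Definition grading_op w : direct_sum V V := (w.1, - w.2).

End FredholmData.

(* Main.v *)
Require Import Defs.
From mathcomp Require Import all_boot all_order all_algebra.
From mathcomp Require Import generic_quotient.
From mathcomp Require Import finmap complex.
From mathcomp Require Import all_classical all_reals.
From mathcomp Require Import topology normedtype sequences esum trigo.
From mathcomp Require Import ring lra.

Set Implicit Arguments.
Unset Strict Implicit.
Unset Printing Implicit Defensive.

Import Order.TTheory GRing.Theory Num.Theory.
Import numFieldNormedType.Exports.

Local Open Scope classical_set_scope.
Local Open Scope ring_scope.

(** Write [D x = pi_p x - pi_m x].  The commutator of the flip with
    [pi_p x (+) pi_m x] is the off-diagonal operator with entries [- D x] and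
    [D x], so everything reduces to the size of [D x].  The two representations
    agree on all generators except [zeta_n], where they differ by twice
    [q ^ (|k| + n)] up to a phase, [|k|] being the sum of the [k_i].  As the
    other generators and their adjoints send basis vectors to multiples of basis
    vectors and lower [|k|] by at most one, the estimate
    [|D x e_k| <= C q ^ |k|] survives multiplication of [x] on the right by any
    generator, hence holds for all [x] ([decay_all]).  A product of geometric
    series ([sum_expr_weight]) then gives [sum_k |D x e_k| < oo].

    The analytic half says that a bounded operator [T] which has an adjoint and
    satisfies [sum_i |T e_i| < oo] over one orthonormal basis is compact and
    trace class.  It is compact because [T v] is, uniformly on the unit ball,
    close to the finite sums of the [<v, e_i> T e_i]
    ([basis_summable_compact]).  It is trace class because
    [<|T| e_i, e_i> <= | |T| e_i | = |T e_i|] ([basis_summable_trace_class]).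
    The operator [|T|] is a multiple of the square root of a positive
    contraction, which is constructed in [positive_sqrt] as the limit of an
    explicit iteration. *)

(** * Inner products and adjoints *)

Section HilbertBasics.
Variables (R : realType) (H : hilbertType R).
Implicit Types (u v w : H) (S T : H -> H).

Lemma dot0r w : dot w (0 : H) = 0.
Proof. by rewrite dot_sym dot0l conjC0. Qed.

Lemma dotNl u w : dot (- u) w = - dot u w.
Proof. by rewrite -scaleN1r dotZl mulN1r. Qed.

Lemma dotNr u w : dot w (- u) = - dot w u.
Proof. by rewrite dot_sym dotNl rmorphN /= -dot_sym. Qed.

Lemma dotBl u v w : dot (u - v) w = dot u w - dot v w.
Proof. by rewrite dotDl dotNl. Qed.

Lemma dotBr u v w : dot w (u - v) = dot w u - dot w v.
Proof. by rewrite dotDr dotNr. Qed.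

Lemma dot_suml (I : Type) (s : seq I) (F : I -> H) w :
  dot (\sum_(i <- s) F i) w = \sum_(i <- s) dot (F i) w.
Proof.
by apply: (big_morph (fun u => dot u w)) => [u v|]; rewrite ?dotDl ?dot0l.
Qed.

Lemma dot_sumr (I : Type) (s : seq I) (F : I -> H) w :
  dot w (\sum_(i <- s) F i) = \sum_(i <- s) dot w (F i).
Proof. by apply: (big_morph (dot w)) => [u v|]; rewrite ?dotDr ?dot0r. Qed.

Lemma cauchy_schwarz u v : `|dot u v| <= `|u| * `|v|.
Proof.
have [->|v0] := eqVneq v 0; first by rewrite dot0r !normr0 mulr0.
rewrite -(@ler_pXn2r _ 2)// ?nnegrE ?mulr_ge0// exprMn.
have := exprn_ge0 2 (normr_ge0 (`|v| ^+ 2 *: u - dot u v *: v)).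
rewrite -dot_norm dotBl !dotBr !dotZl !dotZr !dot_norm (dot_sym v u).
have -> : (`|v| ^+ 2)^* = `|v| ^+ 2 by rewrite conj_Creal// rpredX// ger0_real.
set a := `|u|; set b := `|v|; set c := dot u v.
have -> : b ^+ 2 * (b ^+ 2 * a ^+ 2) - b ^+ 2 * (c^* * c) -
   (c * (b ^+ 2 * c^*) - c * (c^* * b ^+ 2)) = b ^+ 2 * (a ^+ 2 * b ^+ 2 - c * c^*).
  by ring.
by rewrite pmulr_rge0 ?exprn_gt0 ?normr_gt0// -normCK subr_ge0.
Qed.

Lemma dot_eq0 u : (forall v, dot u v = 0) -> u = 0.
Proof.
by move=> /(_ u)/eqP; rewrite dot_norm expf_eq0/= normr_eq0 => /eqP.
Qed.

(** The bound in [bounded_operator] is an arbitrary complex number; when [H] is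
    zero it need not be real, hence the passage to its absolute value. *)
Lemma bounded_operator_ge0 T : bounded_operator T ->
  exists2 M : R[i], 0 <= M & forall v, `|T v| <= M * `|v|.
Proof.
move=> [_ [M TM]]; exists `|M| => // v.
rewrite (le_trans (TM v))// -[X in _ <= _ * X]normr_id -normrM ger0_norm//.
exact: le_trans (TM v).
Qed.

Lemma adjoint_sym S T : adjoint_to S T -> adjoint_to T S.
Proof. by move=> ST u v; rewrite dot_sym -ST -dot_sym. Qed.

Lemma adjoint_linear S T : adjoint_to S T -> linear T.
Proof.
move=> ST a u v; apply/eqP; rewrite -subr_eq0; apply/eqP/dot_eq0 => w.
have TS := adjoint_sym ST.
by rewrite dotBl dotDl dotZl !TS -dotZl -dotDl subrr.
Qed.

Section LinearOp.
Variable T : H -> H.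
Hypothesis lT : linear T.

Lemma linear_opD u v : T (u + v) = T u + T v.
Proof. by have := lT 1 u v; rewrite !scale1r. Qed.

Lemma linear_op0 : T 0 = 0.
Proof. by apply: (addrI (T 0)); rewrite -linear_opD !addr0. Qed.

Lemma linear_opZ a u : T (a *: u) = a *: T u.
Proof. by have := lT a u 0; rewrite linear_op0 !addr0. Qed.

Lemma linear_opB u v : T (u - v) = T u - T v.
Proof. by rewrite linear_opD -scaleN1r linear_opZ scaleN1r. Qed.

Lemma linear_op_sum (I : Type) (s : seq I) (F : I -> H) :
  T (\sum_(i <- s) F i) = \sum_(i <- s) T (F i).
Proof. exact: (big_morph T linear_opD linear_op0). Qed.
End LinearOp.

End HilbertBasics.

(** * Square roots of positive contractions *)

Section Scalars.
Variable R : realType.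

(** The numbers [1 - b n], where [b 0 = 0] and [b n.+1 = (1 + b n ^+ 2) / 2]:
    the errors in the scalar case of the iteration [sqrt_iter] below. *)
Fixpoint sqrt_gap (n : nat) : R :=
  if n is m.+1 then sqrt_gap m - sqrt_gap m ^+ 2 / 2 else 1.

(** The upper bound is preserved because [x - x ^+ 2 / 2] increases with [x]
    on [[0, 1]] and [(m - 1) * (m + 1) <= m ^+ 2]. *)
Lemma sqrt_gap_bound n : 0 <= sqrt_gap n <= 2 / n.+2%:R.
Proof.
elim: n => [|n /andP[IH0 IH1]] /=; first by rewrite ler01 divff ?pnatr_eq0 ?lexx.
have m2 : 2 <= n.+2%:R :> R by rewrite ler_nat.
have -> : n.+3%:R = n.+2%:R + 1 :> R by rewrite -[n.+3]addn1 natrD.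
move: (sqrt_gap n) (n.+2%:R : R) m2 IH0 IH1 => x m m2 x0.
have m0 : 0 < m by rewrite (lt_le_trans _ m2).
rewrite !ler_pdivlMr ?addr_gt0// => xm.
have x1 : x <= 1 by nra.
apply/andP; split; first by nra.
have -> : (x - x ^+ 2 / 2) * (m + 1) = (x * m) + x - x * x / 2 - (x * m) * x / 2.
  by field.
by nra.
Qed.

Local Notation g n := (sqrt_gap n)%:C%C.

Lemma sqrt_gapC0 : g 0 = 1. Proof. by []. Qed.

Lemma sqrt_gapCS n : g n.+1 = g n - g n ^+ 2 / 2.
Proof. by rewrite /= rmorphB/= rmorphM/= rmorphXn/= fmorphV/= rmorph_nat. Qed.

Lemma sqrt_gapC_ge0 n : 0 <= g n.
Proof. by rewrite ler0c; case/andP: (sqrt_gap_bound n). Qed.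

Lemma sqrt_gapC_le1 n : g n <= 1.
Proof.
have -> : 1 = (1 : R)%:C%C by [].
rewrite lecR; case/andP: (sqrt_gap_bound n) => _ /le_trans; apply.
by rewrite ler_pdivrMr// mul1r ler_nat.
Qed.

Lemma sqrt_gapCS_le n : g n.+1 <= g n.
Proof.
by rewrite sqrt_gapCS gerBl mulr_ge0// ?exprn_ge0 ?sqrt_gapC_ge0// invr_ge0.
Qed.

Lemma sqrt_gap_cvg0 (e : R[i]) : 0 < e -> exists N, g N <= e.
Proof.
move=> e0; have er : e = (complex.Re e)%:C%C by rewrite RRe_real// gtr0_real.
move: e0; rewrite er ltcR; set r := complex.Re e => r0 {er}.
exists (Num.truncn (2 / r)); rewrite lecR.
have /andP[_ /le_trans] := sqrt_gap_bound (Num.truncn (2 / r)); apply.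
rewrite ler_pdivrMr// mulrC -ler_pdivrMr//.
have := truncnS_gt (2 / r) => /ltW/le_trans; apply.
by rewrite ler_nat.
Qed.

(** Identities between limits of the iteration are proved by bounding the norm
    of the difference of both sides by a multiple of every [sqrt_gap]. *)
Lemma le_sqrt_gapC_eq0 (x K : R[i]) : 0 <= x -> 0 <= K ->
  (forall n, x <= g n * K) -> x = 0.
Proof.
move=> x0 K0 xg; apply: le_anti; rewrite x0 andbT.
apply/ler_addgt0Pr => e e0; rewrite add0r.
have K1 : 0 < K + 1 by rewrite ltr_wpDl.
have [|N gN] := @sqrt_gap_cvg0 (e / (K + 1)); first by rewrite divr_gt0.
rewrite (le_trans (xg N))// (@le_trans _ _ (e / (K + 1) * K))//.
  exact: ler_wpM2r.
by rewrite -mulrA ger_pMr// ler_pdivrMl// mulr1 lerDl.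
Qed.

End Scalars.

Section SquareRoot.
Variables (R : realType) (H : hilbertType R) (P : H -> H).
Hypotheses (lP : linear P) (sP : self_adjoint P).
Hypothesis P1 : forall v, `|v - P v| <= `|v|.
Implicit Types (u v w : H).
Local Notation g n := (sqrt_gap R n)%:C%C.

(** The iteration [B |-> (A + B ^+ 2) / 2] from [0], for [A = 1 - P]. *)
Fixpoint sqrt_iter (n : nat) (v : H) : H :=
  if n is m.+1 then 2^-1 *: (v - P v + sqrt_iter m (sqrt_iter m v)) else 0.
Local Notation B := sqrt_iter.

Lemma sqrt_iter_linear n : linear (B n).
Proof.
elim: n => [|n IH] a u v; first by rewrite /= scaler0 addr0.
rewrite /= lP !IH opprD (addrACA (a *: u)) (addrACA (a *: u - _)).
rewrite -scalerBr -(scalerDr a (u - P u)).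
by rewrite [LHS]scalerDr !scalerA mulrC.
Qed.

Lemma half_conj : (2^-1 : R[i])^* = 2^-1.
Proof. by rewrite fmorphV/= conjC_nat. Qed.

Lemma sqrt_iter_self_adjoint n : self_adjoint (B n).
Proof.
elim: n => [|n IH] u v /=; first by rewrite dot0l dot0r.
by rewrite dotZl dotZr half_conj !dotDl !dotDr dotNl dotNr sP !IH.
Qed.

Lemma sqrt_iter_norm n v : `|B n v| <= (1 - g n) * `|v|.
Proof.
elim: n v => [|n IH] v; first by rewrite /= normr0 subrr mul0r.
rewrite [B _ _]/= normrZ ger0_norm ?invr_ge0// ler_pdivrMl//.
rewrite (le_trans (ler_normD _ _))//.
have -> : 2 * ((1 - g n.+1) * `|v|) = `|v| + (1 - g n) * ((1 - g n) * `|v|).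
  by rewrite sqrt_gapCS; field.
rewrite lerD ?P1// (le_trans (IH _))// ler_wpM2l ?IH// subr_ge0.
exact: sqrt_gapC_le1.
Qed.

(** The increments are those of the scalar case at most, because
    [B' ^+ 2 - B ^+ 2 = B' (B' - B) + (B' - B) B]. *)
Lemma sqrt_iterS n v : `|B n.+1 v - B n v| <= (g n - g n.+1) * `|v|.
Proof.
elim: n v => [|n IH] v.
  rewrite [B 0 v]/= [B 1 v]/= addr0 subr0 normrZ ger0_norm ?invr_ge0//.
  rewrite sqrt_gapCS sqrt_gapC0 expr1n.
  have -> : 1 - (1 - 1 / 2) = 2^-1 :> R[i] by field.
  by rewrite ler_wpM2l ?invr_ge0.
have -> : B n.+2 v - B n.+1 v =
   2^-1 *: (B n.+1 (B n.+1 v - B n v) + (B n.+1 (B n v) - B n (B n v))).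
  rewrite (linear_opB (sqrt_iter_linear n.+1)).
  rewrite -[in LHS]/(2^-1 *: (v - P v + B n.+1 (B n.+1 v))).
  rewrite [in X in _ - X]/=  -scalerBr; congr (_ *: _).
  by rewrite addrA subrK opprD addrACA subrr add0r.
rewrite normrZ ger0_norm ?invr_ge0// ler_pdivrMl//.
rewrite (le_trans (ler_normD _ _))//.
have -> : 2 * ((g n.+1 - g n.+2) * `|v|) =
  (1 - g n.+1) * ((g n - g n.+1) * `|v|) + (g n - g n.+1) * ((1 - g n) * `|v|).
  by rewrite !sqrt_gapCS; field.
rewrite lerD//.
  rewrite (le_trans (sqrt_iter_norm _ _))// ler_wpM2l ?IH// subr_ge0.
  exact: sqrt_gapC_le1.
rewrite (le_trans (IH _))// ler_wpM2l ?sqrt_iter_norm// subr_ge0.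
exact: sqrt_gapCS_le.
Qed.

Lemma sqrt_iter_cauchy m n v : (m <= n)%N ->
  `|B n v - B m v| <= g m * `|v|.
Proof.
move=> mn; apply: (@le_trans _ _ ((g m - g n) * `|v|)); last first.
  by rewrite ler_wpM2r// gerBl sqrt_gapC_ge0.
elim: n mn => [|n IH].
  by rewrite leqn0 => /eqP ->; rewrite !subrr normr0 mul0r.
rewrite leq_eqVlt => /predU1P[->|]; first by rewrite !subrr normr0 mul0r.
rewrite ltnS => /IH mn.
have -> : B n.+1 v - B m v = (B n.+1 v - B n v) + (B n v - B m v).
  by rewrite addrA subrK.
have -> : (g m - g n.+1) * `|v| = (g n - g n.+1) * `|v| + (g m - g n) * `|v|.
  by ring.
by rewrite (le_trans (ler_normD _ _))// lerD// sqrt_iterS.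
Qed.

Lemma sqrt_iter_limit : {C : H -> H | forall n v, `|C v - B n v| <= g n * `|v|}.
Proof.
suff h v : {l : H | forall n, `|l - B n v| <= g n * `|v|}.
  by exists (fun v => sval (h v)) => n v; exact: (svalP (h v)).
have cB : cvg (B ^~ v @ \oo).
  apply: cauchy_cvg; apply: cauchy_exP => e e0.
  have v1 : 0 < `|v| + 1 by rewrite ltr_wpDl.
  have [|N gN] := @sqrt_gap_cvg0 R (e / 2 / (`|v| + 1)); first by rewrite !divr_gt0.
  exists (B N v); suff : \forall n \near \oo, ball (B N v) e (B n v) by [].
  near=> n; rewrite -ball_normE /ball_/= distrC.
  apply: (@le_lt_trans _ _ (g N * `|v|)).
    by apply: sqrt_iter_cauchy; near: n; exact: nbhs_infty_ge.
  apply: (@le_lt_trans _ _ (e / 2 / (`|v| + 1) * `|v|)); first exact: ler_wpM2r.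
  apply: (@le_lt_trans _ _ (e / 2)).
    by rewrite -mulrA ger_pMr ?divr_gt0// ler_pdivrMl// mulr1 lerDl.
  by rewrite ltr_pdivrMr// ltr_pMr// ltr1n.
exists (lim (B ^~ v @ \oo)) => m.
apply/ler_addgt0Pr => e e0.
have /cvgrPdist_lt/(_ _ e0) [N _ hN] := cB.
pose n := maxn m N.
have -> : lim (B ^~ v @ \oo) - B m v =
   (B n v - B m v) + (lim (B ^~ v @ \oo) - B n v) by rewrite [RHS]addrC addrA subrK.
rewrite (le_trans (ler_normD _ _))// lerD// ?sqrt_iter_cauchy ?leq_maxl//.
by apply/ltW/hN; rewrite /= leq_maxr.
Unshelve. all: by end_near. Qed.

(** With [P = 1 - A], the fixed points of [B |-> (A + B ^+ 2) / 2] are the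
    [1 - S] with [S ^+ 2 = P].  Since [A] is a contraction, the iterates are
    dominated in norm by those of the scalar case [A = 1], which increase to
    [1]; so they converge in norm to some [C] with [|C| <= 1], and [1 - C] is
    positive. *)
Lemma positive_sqrt : exists S,
  [/\ positive_operator S, self_adjoint S & forall v, S (S v) = P v].
Proof.
have [C CB] := sqrt_iter_limit.
have BC n v : `|B n v - C v| <= g n * `|v| by rewrite distrC.
have CN v : `|C v| <= `|v|.
  rewrite -[C v](subrK (B 0 v)) (le_trans (ler_normD _ _))//.
  rewrite [X in _ + X]normr0 addr0 (le_trans (CB 0 v))// mul1r//.
have lC : linear C.
  move=> a u v; apply/eqP; rewrite -subr_eq0 -normr_eq0; apply/eqP.
  apply: (@le_sqrt_gapC_eq0 _ _ (`|a *: u + v| + (`|a| * `|u| + `|v|))) => //.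
    by rewrite !addr_ge0// mulr_ge0.
  move=> n.
  have -> : C (a *: u + v) - (a *: C u + C v) =
    (C (a *: u + v) - B n (a *: u + v)) + (a *: (B n u - C u) + (B n v - C v)).
    by rewrite scalerBr (addrACA (a *: _)) -opprD -sqrt_iter_linear addrA subrK.
  rewrite !mulrDr (le_trans (ler_normD _ _))// lerD ?CB//.
  rewrite (le_trans (ler_normD _ _))// lerD ?BC// normrZ mulrCA.
  by rewrite ler_wpM2l.
have sC : self_adjoint C.
  move=> u v; apply/eqP; rewrite -subr_eq0 -normr_eq0; apply/eqP.
  apply: (@le_sqrt_gapC_eq0 _ _ (`|u| * `|v| + `|u| * `|v|)) => //.
    by rewrite addr_ge0// mulr_ge0.
  move=> n.
  have -> : dot (C u) v - dot u (C v) = dot (C u - B n u) v + dot u (B n v - C v).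
    by rewrite dotBl dotBr sqrt_iter_self_adjoint addrA subrK.
  rewrite mulrDr (le_trans (ler_normD _ _))// lerD//.
    by rewrite (le_trans (cauchy_schwarz _ _))// mulrA ler_wpM2r.
  by rewrite (le_trans (cauchy_schwarz _ _))// mulrCA ler_wpM2l.
have CE v : 2 *: C v = v - P v + C (C v).
  apply/eqP; rewrite -subr_eq0 -normr_eq0; apply/eqP.
  apply: (@le_sqrt_gapC_eq0 _ _ (2 * `|v| + (`|v| + `|v|))) => //.
    by rewrite !addr_ge0// mulr_ge0.
  move=> n.
  have -> : 2 *: C v - (v - P v + C (C v)) = 2 *: (C v - B n.+1 v) +
       (B n (B n v - C v) + (B n (C v) - C (C v))).
    rewrite scalerBr [B n.+1 v]/= scalerA mulfV ?pnatr_eq0// scale1r.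
    rewrite (linear_opB (sqrt_iter_linear n)) (addrA (_ - B n (C v))) subrK.
    rewrite !(opprD (v - P v)) -(addrA (2 *: C v)); congr (_ + _).
    by rewrite [RHS]addrA subrK.
  rewrite !mulrDr (le_trans (ler_normD _ _))// lerD//.
    rewrite normrZ ger0_norm// mulrCA ler_wpM2l// (le_trans (CB _ _))//.
    by rewrite ler_wpM2r// sqrt_gapCS_le.
  rewrite (le_trans (ler_normD _ _))// lerD//.
    rewrite (le_trans (sqrt_iter_norm _ _))//.
    apply: (@le_trans _ _ (1 * (g n * `|v|))); last by rewrite mul1r.
    rewrite ler_pM// ?subr_ge0 ?sqrt_gapC_le1// gerBl.
    exact: sqrt_gapC_ge0.
  by rewrite (le_trans (BC _ _))// ler_wpM2l// ?sqrt_gapC_ge0.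
exists (fun v => v - C v); split; last first.
- move=> v; rewrite (linear_opB lC).
  have -> : v - C v - (C v - C (C v)) = v + C (C v) - 2 *: C v.
    by rewrite opprB addrACA -opprD scaler_nat mulr2n.
  by rewrite CE opprD addrACA subrr addr0 opprB addrC subrK.
- by move=> u v; rewrite dotBl dotBr sC.
split; first split.
- by move=> a u v; rewrite lC scalerBr opprD addrACA.
- exists 2 => v; rewrite (le_trans (ler_normB _ _))//.
  by rewrite mulr_natl mulr2n lerD.
- move=> v; rewrite dotBl subr_ge0 dot_norm.
  have Cr : dot (C v) v \is Num.real by rewrite CrealE {2}sC -dot_sym.
  rewrite (le_trans (real_ler_norm Cr))// (le_trans (cauchy_schwarz _ _))//.
  by rewrite expr2 ler_wpM2r.
Qed.

End SquareRoot.

(** * Precompactness in a Hilbert space *)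

Section Precompact.
Variables (R : realType) (H : hilbertType R).
Implicit Types (u v w : H) (A K : set H).

(** An ultrafilter [F] containing the closure of [A] must contain some ball
    around a point of the compact set [K]: otherwise each point of [K] has a
    neighbourhood all of whose points are far from [F]-almost every [u], and by
    compactness [F]-almost every [u] is far from all of [K].  So [F] is
    Cauchy. *)
Lemma precompact_near_compact A :
  (forall e : R[i], 0 < e -> exists2 K, compact K &
     forall u, A u -> exists2 v, K v & ball v e u) -> precompact A.
Proof.
move=> AK; rewrite precompactE compact_ultra => F UF FA.
have PF : ProperFilter F by exact: ultra_proper.
suff : cvg F.
  move=> /cvg_ex[l Fl]; exists l; split => //.
  apply: closed_closure => B /Fl FB.
  exact: (filter_ex (filterI FA FB)).
apply: cauchy_cvg; apply: cauchy_exP => e e0.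
have e20 : 0 < e / 2 by rewrite divr_gt0.
have e40 : 0 < e / 2 / 2 by rewrite divr_gt0.
have [K cK {}AK] := AK _ e40.
apply: contrapT => /forallNP nF.
have Fnot : \forall u \near F, forall v, K v -> ~ ball v (e / 2) u.
  move/compact_near_coveringP : cK; apply => x Kx.
  have [|Fx] := in_ultra_setVsetC (ball x e) UF; first by move=> /(nF x).
  near=> y u => /= yu.
  have : (~` ball x e) u by near: u.
  apply; rewrite [e]splitr; apply: ball_triangle yu.
  by near: y; exact: nbhsx_ballx.
have [u [uA /= notK]] := filter_ex (filterI FA Fnot).
have [w [Aw uw]] : A `&` ball u (e / 2 / 2) !=set0.
  by apply: uA; exact: nbhsx_ballx.
have [v Kv vw] := AK _ Aw.
apply: (notK v Kv).
by rewrite [e / 2]splitr; apply: (ball_triangle vw); exact: ball_sym.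
Unshelve. all: by end_near. Qed.

Lemma normr_real_complex (x : R) : `|x%:C%C| = `|x|%:C%C.
Proof. by rewrite normc_def /= expr0n addr0 sqrtr_sqr. Qed.

Lemma unit_disc_in_compact : exists2 D : set R[i]^o, compact D &
  forall z : R[i], `|z| <= 1 -> D z.
Proof.
pose f (p : R * R) : R[i]^o := Complex p.1 p.2.
exists (f @` (`[-1, 1] `*` `[-1, 1])).
  apply: continuous_compact; last by apply: compact_setX; exact: segment_compact.
  apply: continuous_subspaceT => -[a b].
  apply/cvgrPdist_lt => e e0.
  have er : e = (complex.Re e)%:C%C by rewrite RRe_real// gtr0_real.
  move: e0; rewrite er ltcR; set r := complex.Re e => r0.
  have r20 : 0 < r / 2 by rewrite divr_gt0.
  near=> p; have [pa pb] : `|a - p.1| < r / 2 /\ `|b - p.2| < r / 2.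
    near: p; exists (ball a (r / 2), ball b (r / 2)).
      by split; exact: nbhsx_ballx.
    by move=> p [].
  have -> : f (a, b) - f p = (a - p.1)%:C%C + 'i%C * (b - p.2)%:C%C.
    by rewrite [p]surjective_pairing /f; simpc.
  rewrite (le_lt_trans (ler_normD _ _))// normrM complexiE normCi mul1r.
  by rewrite !normr_real_complex -rmorphD/= ltcR [r]splitr ltrD.
move=> [a b] z1; exists (a, b) => //.
have : a ^+ 2 + b ^+ 2 <= 1.
  rewrite -lecR (add_Re2_Im2 (Complex a b)).
  by rewrite expr_le1.
by split; rewrite /= in_itv/=; apply/andP; split; nra.
Unshelve. all: by end_near. Qed.

(** The compact set is the image under [c |-> sum_i c_i w_i] of a power of a
    compact set that contains the unit disc. *)
Lemma finite_span_compact (I : Type) (w : I -> H) (s : seq I) :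
  exists2 K : set H, compact K & forall c : I -> R[i],
    (forall i, `|c i| <= 1) -> K (\sum_(i <- s) c i *: w i).
Proof.
have [D cD D1] := unit_disc_in_compact.
elim: s => [|i s [K cK Ks]].
  by exists [set 0]; [exact: compact_set1|move=> c _; rewrite big_nil].
exists ((fun p : R[i]^o * H => p.1 *: w i + p.2) @` (D `*` K)).
  apply: continuous_compact; last exact: compact_setX.
  apply: continuous_subspaceT => p.
  apply: cvgD; last exact: cvg_snd.
  by apply: cvgZr_tmp; exact: cvg_fst.
move=> c c1; exists (c i, \sum_(j <- s) c j *: w j) => /=.
  by split => /=; [exact/D1/c1|exact: Ks].
by rewrite big_cons.
Qed.

End Precompact.

(** * Orthonormal expansions and a trace class criterion *)

Section Expansion.
Variables (R : realType) (H : hilbertType R) (I : choiceType) (e : I -> H).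
Hypothesis he : orthonormal_basis e.
Implicit Types (u v w : H) (s : seq I).

Definition partial_expansion s v := \sum_(i <- s) dot v (e i) *: e i.

Lemma orthonormal_norm i : `|e i| = 1.
Proof.
apply/eqP; rewrite -(@eqrXn2 _ 2)// expr1n -dot_norm he.1 eqxx.
by [].
Qed.

Lemma dot_partial_expansion s v i : uniq s -> i \in s ->
  dot (v - partial_expansion s v) (e i) = 0.
Proof.
move=> us si; rewrite dotBl dot_suml (bigD1_seq i)//= dotZl he.1 eqxx mulr1.
rewrite big1 ?addr0 ?subrr// => j ji.
by rewrite dotZl he.1 (negPf ji) mulr0.
Qed.

(** Pythagoras: the residual is orthogonal to the span of the [e i], [i \in s].
    The indices in [t] may repeat. *)
Lemma partial_expansion_best s t (c : I -> R[i]) v : uniq s ->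
  {subset t <= s} ->
  `|v - partial_expansion s v| <= `|v - \sum_(i <- t) c i *: e i|.
Proof.
move=> us ts; set w := \sum_(i <- t) _; set p := partial_expansion s v.
(* [v - p] is orthogonal to both [p] and [w]. *)
have os r (a : I -> R[i]) : {subset r <= s} ->
    dot (v - p) (\sum_(i <- r) a i *: e i) = 0.
  move=> rs; rewrite dot_sumr big_seq big1// => i /rs si.
  by rewrite dotZr dot_partial_expansion// mulr0.
have o : dot (v - p) (p - w) = 0 by rewrite dotBr !os ?subr0.
rewrite -(@ler_pXn2r _ 2)// ?nnegrE//.
have -> : v - w = (v - p) + (p - w) by rewrite addrA subrK.
rewrite -!dot_norm [X in _ <= X]dotDl !(dotDr (v - p)) o addr0.
by rewrite (dot_sym (p - w) (v - p)) o conjC0 add0r lerDl dot_norm exprn_ge0.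
Qed.

Lemma partial_expansion_dense s v (d : R[i]) : 0 < d ->
  exists t, [/\ uniq t, {subset s <= t} & `|v - partial_expansion t v| < d].
Proof.
move=> d0; have : closure [set u | exists (t : seq I) (c : I -> R[i]),
    u = \sum_(i <- t) c i *: e i] v by rewrite he.2.
move=> /(_ _ (nbhsx_ballx v d d0))[_ [[t [c ->]]]].
rewrite -ball_normE /ball_/= => vd; exists (undup (s ++ t)).
split; [exact: undup_uniq| |].
  by move=> i si; rewrite mem_undup mem_cat si.
apply: le_lt_trans vd; apply: partial_expansion_best; first exact: undup_uniq.
by move=> i ti; rewrite mem_undup mem_cat ti orbT.
Qed.

Lemma orthonormal_basis_inj v : (forall i, dot v (e i) = 0) -> v = 0.
Proof.
move=> v0; apply/eqP/negPn; rewrite -normr_gt0; apply/negP => vgt0.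
have [t [_ _]] := partial_expansion_dense [::] v vgt0.
rewrite /partial_expansion big1 ?subr0 ?ltxx// => i _.
by rewrite v0 scale0r.
Qed.

End Expansion.

Section BasisSummable.
Variables (R : realType) (H : hilbertType R) (I : choiceType) (e : I -> H).
Hypothesis he : orthonormal_basis e.
Implicit Types (u v w : H) (s : seq I) (T : H -> H).

Definition basis_summable T :=
  exists M : R, forall s, uniq s -> \sum_(i <- s) `|T (e i)| <= M%:C%C.

(** A finite set [s] whose sum is within [d] of the supremum of all finite sums
    leaves at most [d] for the indices outside [s]. *)
Lemma basis_summable_tail T (d : R[i]) : 0 < d -> basis_summable T ->
  exists2 s, uniq s & forall t, uniq t -> {subset s <= t} ->
    \sum_(i <- t | i \notin s) `|T (e i)| <= d.
Proof.
move=> d0 [M TM].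
have dr : d = (complex.Re d)%:C%C by rewrite RRe_real// gtr0_real.
move: d0; rewrite dr ltcR; set r := complex.Re d => r0 {dr}.
pose a i := complex.Re `|T (e i)|.
have aE i : `|T (e i)| = (a i)%:C%C by rewrite RRe_real// ger0_real.
pose E := [set x : R | exists2 s, uniq s & x = \sum_(i <- s) a i].
have E_sup : has_sup E.
  split; first by exists 0, [::] => //; rewrite big_nil.
  exists M => _ [s us ->]; rewrite -lecR rmorph_sum/=.
  by under eq_bigr do rewrite -aE; exact: TM.
have [_ [s us ->] sr] := sup_adherent r0 E_sup.
exists s => // t ut st; under eq_bigr do rewrite aE.
rewrite -rmorph_sum lecR.
have : E (\sum_(i <- t) a i) by exists t.
move/(sup_upper_bound E_sup); rewrite (bigID (mem s))/=.
have -> : \sum_(i <- t | i \in s) a i = \sum_(i <- s) a i.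
  rewrite -big_filter; apply: perm_big; apply: uniq_perm => //.
    exact: filter_uniq.
  move=> i; rewrite mem_filter; case: (boolP (i \in s)) => // /st ->.
  by [].
by move: sr; lra.
Qed.

(** On the unit ball, [T v] differs from [sum_(i <- s) <v, e i> T (e i)] by at
    most the tail of the norms [|T (e i)|] outside [s], as the coefficients
    have modulus at most one; these finite sums stay in a compact set. *)
Lemma basis_summable_compact T : bounded_operator T -> basis_summable T ->
  compact_operator T.
Proof.
move=> bT sT; split; first exact: bT.1.
have lT := bT.1; have [M M0 TM] := bounded_operator_ge0 bT.
apply: precompact_near_compact => d d0.
have d20 : 0 < d / 2 by rewrite divr_gt0.
have [s us st] := basis_summable_tail d20 sT.
have [K cK Ks] := finite_span_compact (fun i => T (e i)) s.
exists K => // _ [v /= v1 <-].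
have c1 i : `|dot v (e i)| <= 1.
  by rewrite (le_trans (cauchy_schwarz _ _))// (orthonormal_norm he) mulr1.
exists (\sum_(i <- s) dot v (e i) *: T (e i)); first exact: Ks.
rewrite -ball_normE /ball_/= distrC.
have [|t [ut sst vt]] := @partial_expansion_dense _ _ _ _ he s v (d / 2 / (M + 1)).
  by rewrite !divr_gt0// ltr_wpDl.
(* Expand [v] further, over [t] containing [s]: what is added is the tail. *)
have -> : T v - \sum_(i <- s) dot v (e i) *: T (e i) =
  T (v - partial_expansion e t v) +
  \sum_(i <- t | i \notin s) dot v (e i) *: T (e i).
  rewrite (linear_opB lT) (linear_op_sum lT) -addrA; congr (_ + _).
  under [X in _ = - X + _]eq_bigr do rewrite (linear_opZ lT).
  rewrite [in RHS](bigID (mem s))/= opprD addrNK; congr (- _).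
  rewrite -[RHS]big_filter; apply: perm_big; apply: uniq_perm => //.
    exact: filter_uniq.
  by move=> i; rewrite mem_filter; case: (boolP (i \in s)) => // /sst ->.
rewrite [d]splitr (le_lt_trans (ler_normD _ _))// ltr_leD//.
  rewrite (le_lt_trans (TM _))//.
  apply: (@le_lt_trans _ _ (M * (d / 2 / (M + 1)))).
    by rewrite ler_wpM2l// ltW.
  rewrite mulrCA gtr_pMr// ltr_pdivrMr ?ltr_wpDl// mul1r ltrDl.
  exact: ltr01.
rewrite (le_trans _ (st t ut sst))// (le_trans (ler_norm_sum _ _ _))//.
apply: ler_sum => i _; rewrite normrZ -[X in _ <= X]mul1r.
by rewrite ler_wpM2r.
Qed.

(** With [m] a bound of [T], [P = T^* T / m ^+ 2] satisfies
    [|P v| ^+ 2 <= <P v, v>], whence [|v - P v| <= |v|]; the absolute value is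
    [m] times the square root of [P]. *)
Lemma absolute_value_exists T T' : bounded_operator T -> adjoint_to T T' ->
  exists2 S, absolute_value T S & forall v, `|S v| = `|T v|.
Proof.
move=> bT aT; have lT := bT.1; have [M M0 TM] := bounded_operator_ge0 bT.
have lT' := adjoint_linear aT; have aT' := adjoint_sym aT.
(* Adding one makes the bound positive, hence invertible, even if [T] is zero. *)
have M10 : 0 < M + 1 by rewrite ltr_wpDl.
have Tm v : `|T v| <= (M + 1) * `|v|.
  by rewrite (le_trans (TM v))// ler_wpM2r// lerDl.
move: (M + 1) M10 Tm => m m0 Tm {M M0 TM}.
have mV0 : 0 <= m^-1 by rewrite invr_ge0 ltW.
have mVV : m * m^-1 = 1 by rewrite divff// gt_eqF.
have mc : (m^-1)^* = m^-1 by rewrite conj_Creal// ger0_real.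
pose P v := m^-1 ^+ 2 *: T' (T v).
have lP : linear P.
  by move=> a u v; rewrite /P lT lT' scalerDr !scalerA mulrC.
have sP : self_adjoint P.
  by move=> u v; rewrite /P dotZl dotZr rmorphXn/= mc aT' aT.
have PT u v : dot (P u) v = m^-1 ^+ 2 * dot (T u) (T v) by rewrite dotZl aT'.
have PP v : `|P v| <= m^-1 * `|T v|.
  have [->|Pv0] := eqVneq (P v) 0; first by rewrite normr0 mulr_ge0.
  rewrite -(@ler_pM2r _ `|P v|) ?normr_gt0// -expr2 -dot_norm.
  have Pr : dot (P v) (P v) \is Num.real by rewrite dot_norm realX// ger0_real.
  rewrite (le_trans (real_ler_norm Pr))// PT normrM ger0_norm ?exprn_ge0//.
  rewrite expr2 -!mulrA ler_wpM2l//.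
  apply: (@le_trans _ _ (m^-1 * (`|T v| * (m * `|P v|)))).
    rewrite ler_wpM2l// (le_trans (cauchy_schwarz _ _))// ler_wpM2l//.
  by rewrite [_ * (m * _)]mulrCA mulKf ?gt_eqF.
have P1 v : `|v - P v| <= `|v|.
  rewrite -(@ler_pXn2r _ 2)// ?nnegrE// -!dot_norm dotBl !dotBr (sP v v).
  rewrite -(sP v v) PT dot_norm (dot_norm (T v)) (dot_norm (P v)) -exprMn.
  rewrite -addrA gerDl -opprD oppr_le0 addrCA.
  rewrite addr_ge0 ?exprn_ge0 ?mulr_ge0// subr_ge0.
  by rewrite ler_pXn2r ?nnegrE ?mulr_ge0.
have [S [[[lS [N SN]] S0] sS SS]] := positive_sqrt lP sP P1.
have SST v : m *: S (m *: S v) = T' (T v).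
  rewrite (linear_opZ lS) scalerA SS /P scalerA.
  by rewrite -expr2 -exprMn mVV expr1n scale1r.
have sS' : self_adjoint (fun v => m *: S v).
  move=> u v; rewrite dotZl dotZr sS conj_Creal// gtr0_real//.
exists (fun v => m *: S v); last first.
  move=> v; apply/eqP; rewrite -(@eqrXn2 _ 2)// -!dot_norm.
  by rewrite -[dot (m *: _) _]sS' SST aT'.
split; last by exists T'.
split; last by move=> v; rewrite dotZl mulr_ge0// ltW.
split.
  by move=> a u v; rewrite lS scalerDr !scalerA mulrC.
exists (m * N) => v; rewrite normrZ gtr0_norm// -mulrA ler_wpM2l// ltW//.
Qed.

(** [<S (e i), e i> <= |S (e i)| = |T (e i)|] for the absolute value [S]. *)
Lemma basis_summable_trace_class T T' : bounded_operator T ->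
  adjoint_to T T' -> basis_summable T -> trace_class T.
Proof.
move=> bT aT [M TM]; split => //.
have [S aS nS] := absolute_value_exists bT aT; exists S => //.
exists I, e => //; apply: (@le_lt_trans _ _ M%:E); last exact: ltry.
apply: ereal.ge_ereal_sup => _ [A [fA _] <-].
rewrite fsbig_finite//= sumEFin lee_fin -lecR.
apply: le_trans (TM _ (fset_uniq (fset_set A))); rewrite rmorph_sum/=.
apply: ler_sum => i _.
rewrite RRe_real; last by rewrite ger0_real// aS.1.2.
rewrite (le_trans (real_ler_norm _)) ?ger0_real ?aS.1.2//.
rewrite (le_trans (cauchy_schwarz _ _))// (orthonormal_norm he) mulr1.
by rewrite nS.
Qed.

End BasisSummable.

(** * The flip on a direct sum of two representations *)

Section DirectSumBasis.
Variables (R : realType) (U V : hilbertType R) (I J : choiceType).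
Variables (e : I -> U) (f : J -> V).
Local Notation W := (direct_sum U V).

Definition direct_sum_basis (x : I + J) : W :=
  match x with inl i => (e i, 0) | inr j => (0, f j) end.

Lemma direct_sum_dotE (x y : W) : dot x y = dot x.1 y.1 + dot x.2 y.2.
Proof. by []. Qed.

Lemma direct_sum_norm_inl u : `|((u, 0) : W)| = `|u|.
Proof. by rewrite direct_sum_normE /= normr0 expr0n addr0 sqrCK. Qed.

Lemma direct_sum_norm_inr v : `|((0, v) : W)| = `|v|.
Proof. by rewrite direct_sum_normE /= normr0 expr0n add0r sqrCK. Qed.

Hypotheses (he : orthonormal_basis e) (hf : orthonormal_basis f).

Lemma direct_sum_orthonormal_basis : orthonormal_basis direct_sum_basis.
Proof.
split.
  move=> [i|i] [j|j]; rewrite direct_sum_dotE /= ?dot0l ?dot0r ?addr0 ?add0r//.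
    exact: he.1.
  exact: hf.1.
apply/seteqP; split => // w _ B /nbhs_ballP[d d0 dB].
have d20 : 0 < d / 2 by rewrite divr_gt0.
(* The two components are approximated separately, each within [d / 2]. *)
have [s [_ _ sd]] := partial_expansion_dense he [::] w.1 d20.
have [t [_ _ td]] := partial_expansion_dense hf [::] w.2 d20.
pose c (x : I + J) : R[i] :=
  match x with inl i => dot w.1 (e i) | inr j => dot w.2 (f j) end.
have E : \sum_(x <- [seq inl i | i <- s] ++ [seq inr j | j <- t])
    c x *: direct_sum_basis x =
    ((partial_expansion e s w.1, partial_expansion f t w.2) : W).
  rewrite big_cat !big_map/=.
  have -> : \sum_(i <- s) dot w.1 (e i) *: ((e i, 0) : W) =
     ((partial_expansion e s w.1, 0) : W).
    rewrite /partial_expansion.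
    by elim/big_rec2: _ => // i y1 y2 _ ->; congr pair; rewrite /= scaler0 addr0.
  have -> : \sum_(i <- t) dot w.2 (f i) *: ((0, f i) : W) =
     ((0, partial_expansion f t w.2) : W).
    rewrite /partial_expansion.
    by elim/big_rec2: _ => // i y1 y2 _ ->; congr pair; rewrite /= scaler0 addr0.
  by congr pair; rewrite /= ?addr0 ?add0r.
exists ((partial_expansion e s w.1, partial_expansion f t w.2) : W); split.
  by exists ([seq inl i | i <- s] ++ [seq inr j | j <- t]), c; rewrite E.
apply: dB; rewrite -ball_normE /ball_/=.
rewrite (le_lt_trans (direct_sum_norm_leD _))//.
by rewrite [d]splitr ltrD.
Qed.

Lemma sum_seq_inl_inr (F : I + J -> R[i]) (s : seq (I + J)) : uniq s ->
  exists t r, [/\ uniq t, uniq r &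
    \sum_(x <- s) F x = \sum_(i <- t) F (inl i) + \sum_(j <- r) F (inr j)].
Proof.
move=> us.
pose getl (x : I + J) := if x is inl i then Some i else None.
pose getr (x : I + J) := if x is inr j then Some j else None.
exists (pmap getl s), (pmap getr s); split.
- by apply: (@pmap_uniq _ _ getl inl) us => -[].
- by apply: (@pmap_uniq _ _ getr inr) us => -[].
- elim: s {us} => [|[i|j] s IH]; rewrite ?big_nil ?addr0//= !big_cons IH addrA//.
  by rewrite addrCA addrA.
Qed.

End DirectSumBasis.

Section DifferenceModule.
Variables (R : realType) (A : starAlgType R) (V : hilbertType R).
Variables (rho_p rho_m : A -> V -> V).
Hypotheses (hp : star_representation rho_p) (hm : star_representation rho_m).
Local Notation W := (direct_sum V V).
Local Notation rho := (direct_sum_rep rho_p rho_m).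
Local Notation F := (@flip_op R V).
Local Notation G := (@grading_op R V).

Lemma direct_sum_rep_star : star_representation rho.
Proof.
case: hp => bp lp p1 pM pA; case: hm => bm lm m1 mM mA; split.
- move=> x; split.
    move=> a u v; rewrite /direct_sum_rep /= (bp x).1 (bm x).1.
    by [].
  have [M M0 pM'] := bounded_operator_ge0 (bp x).
  have [N N0 mN'] := bounded_operator_ge0 (bm x).
  exists (M + N) => v; rewrite (le_trans (direct_sum_norm_leD _))//= mulrDl.
  rewrite lerD//.
    by rewrite (le_trans (pM' _))// ler_wpM2l// direct_sum_norm1_le.
  by rewrite (le_trans (mN' _))// ler_wpM2l// direct_sum_norm2_le.
- by move=> a x y v; rewrite /direct_sum_rep lp lm.
- by move=> [u v]; rewrite /direct_sum_rep p1 m1.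
- by move=> x y v; rewrite /direct_sum_rep pM mM.
- by move=> x u v; rewrite !direct_sum_dotE /= pA mA.
Qed.

Lemma flip_op_symmetry :
  [/\ bounded_operator F, self_adjoint F & forall w, F (F w) = w].
Proof.
split; last by case.
- split; first by [].
  exists 2 => w; rewrite (le_trans (direct_sum_norm_leD _))//= mulr_natl mulr2n.
  by rewrite lerD// ?direct_sum_norm2_le ?direct_sum_norm1_le.
- by move=> u v; rewrite !direct_sum_dotE /= addrC.
Qed.

Lemma grading_op_symmetry :
  [/\ bounded_operator G, self_adjoint G & forall w, G (G w) = w].
Proof.
split.
- split.
    by move=> a u v; congr pair; rewrite /= ?opprD ?scalerN.
  exists 2 => w; rewrite (le_trans (direct_sum_norm_leD _))//= mulr_natl mulr2n.
  by rewrite normrN lerD// ?direct_sum_norm2_le ?direct_sum_norm1_le.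
- by move=> u v; rewrite !direct_sum_dotE /= dotNl dotNr.
- by case=> u v; rewrite /grading_op /= opprK.
Qed.

Lemma flip_grading w : F (G w) = - G (F w).
Proof. by congr pair; rewrite /= ?opprK. Qed.

Lemma grading_rep x w : G (rho x w) = rho x (G w).
Proof.
case: hm => bm _ _ _ _; congr pair => /=.
by have := linear_opZ (bm x).1 (-1) w.2; rewrite !scaleN1r.
Qed.

Lemma flip_commutatorE x w : commutator F (rho x) w =
  ((rho_m x w.2 - rho_p x w.2, rho_p x w.1 - rho_m x w.1) : W).
Proof. by []. Qed.

Lemma flip_commutator_bounded x : bounded_operator (commutator F (rho x)).
Proof.
have [brho _ _ _ _] := direct_sum_rep_star.
have [bF _ _] := flip_op_symmetry.
have [M M0 rM] := bounded_operator_ge0 (brho x).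
have [N N0 FN] := bounded_operator_ge0 bF.
split.
  move=> a u v; rewrite /commutator (brho x).1 bF.1 bF.1 (brho x).1.
  by rewrite scalerBr opprD addrACA.
exists (N * M + M * N) => v; rewrite /commutator (le_trans (ler_normB _ _))//.
rewrite mulrDl -!mulrA lerD//.
  by rewrite (le_trans (FN _))// ler_wpM2l.
by rewrite (le_trans (rM _))// ler_wpM2l.
Qed.

Lemma flip_commutator_adjoint x : adjoint_to (commutator F (rho x))
  (fun w => - commutator F (rho (star x)) w).
Proof.
have [_ _ _ _ Arho] := direct_sum_rep_star.
have [_ sF _] := flip_op_symmetry.
move=> u v; rewrite /commutator dotBl opprB dotBr.
by rewrite sF Arho Arho sF.
Qed.

Variables (I : choiceType) (e : I -> V).
Hypothesis he : orthonormal_basis e.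
Hypothesis hs : forall x, basis_summable e (fun v => rho_p x v - rho_m x v).

Lemma flip_commutator_summable x :
  basis_summable (direct_sum_basis e e) (commutator F (rho x)).
Proof.
have [M eM] := hs x; exists (M + M) => s us.
have [bp _ _ _ _] := hp; have [bm _ _ _ _] := hm.
have [t [r [ut ur ->]]] :=
  sum_seq_inl_inr (fun y => `|commutator F (rho x) (direct_sum_basis e e y)|) us.
rewrite rmorphD lerD//.
  rewrite (le_trans _ (eM _ ut))// ler_sum// => i _.
  rewrite flip_commutatorE /= (linear_op0 (bp x).1) (linear_op0 (bm x).1) subrr.
  by rewrite direct_sum_norm_inr.
rewrite (le_trans _ (eM _ ur))// ler_sum// => i _.
rewrite flip_commutatorE /= (linear_op0 (bp x).1) (linear_op0 (bm x).1) subrr.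
by rewrite direct_sum_norm_inl distrC.
Qed.

(** The basis vectors [(e i, 0)] and [(0, e i)] each see one off-diagonal entry
    of the commutator, so summability of the difference is summability of the
    commutator, to which both analytic criteria apply. *)
Theorem summable_difference_fredholm :
  even_fredholm_module rho F G /\ one_summable rho F.
Proof.
have bc := flip_commutator_bounded; have sc := flip_commutator_summable.
have hb := direct_sum_orthonormal_basis he he.
split; last first.
  move=> x; exact: (basis_summable_trace_class hb (bc x) (flip_commutator_adjoint x)).
split.
- exact: direct_sum_rep_star.
- exact: flip_op_symmetry.
- exact: grading_op_symmetry.
- exact: flip_grading.
- move=> x; split; first exact: grading_rep.
  exact: (basis_summable_compact hb).
Qed.

End DifferenceModule.

(** * Decay of the difference of the two representations *)

Section GeometricBox.
Variables (R : realType) (n : nat).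
Local Notation index := {ffun 'I_n -> nat}.

Definition weight (k : index) : nat := \sum_(i < n) k i.

(** The indices in [s] lie in a box, over which the sum is the [n]-th power of
    a truncated geometric series. *)
Lemma sum_expr_weight (q : R) (s : seq index) : 0 < q < 1 -> uniq s ->
  \sum_(k <- s) q ^+ weight k <= (1 - q)^-1 ^+ n.
Proof.
move=> /andP[q0 q1] us.
have q1' : 0 < 1 - q by rewrite subr_gt0.
(* A common bound on the coordinates of all the indices in [s]. *)
pose N := (\sum_(k <- s) weight k).+1.
have sN k i : k \in s -> (k i < N)%N.
  move=> ks; rewrite ltnS (bigD1_seq k)//= /weight (bigD1 i)//= -addnA.
  exact: leq_addr.
pose emb (g : {ffun 'I_n -> 'I_N}) : index := [ffun i => g i : nat].
have emb_inj : injective emb.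
  move=> g h /ffunP gh; apply/ffunP => i; apply/val_inj.
  by have := gh i; rewrite !ffunE.
pose box := [seq emb g | g : {ffun 'I_n -> 'I_N}].
have ubox : uniq box by rewrite map_inj_uniq ?enum_uniq.
have sbox : {subset s <= box}.
  move=> k ks; apply/mapP; exists [ffun i => Ordinal (sN k i ks)].
    by rewrite mem_enum.
  by apply/ffunP => i; rewrite !ffunE.
apply: (@le_trans _ _ (\sum_(k <- box) q ^+ weight k)).
  rewrite [leRHS](bigID (mem s))/=.
  have -> : \sum_(k <- box | k \in s) q ^+ weight k = \sum_(k <- s) q ^+ weight k.
    rewrite -big_filter; apply: perm_big; apply: uniq_perm => //.
      exact: filter_uniq.
    by move=> i; rewrite mem_filter; case: (boolP (i \in s)) => // /sbox ->.
  by rewrite lerDl sumr_ge0// => k _; rewrite exprn_ge0// ltW.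
rewrite big_map big_enum/=.
have -> : \sum_(g : {ffun 'I_n -> 'I_N}) q ^+ weight (emb g) =
    \sum_(g : {ffun 'I_n -> 'I_N}) \prod_(i < n) q ^+ g i.
  apply: eq_bigr => g _; rewrite prodrXr; congr (_ ^+ _).
  by apply: eq_bigr => i _; rewrite ffunE.
rewrite -(bigA_distr_bigA (fun=> fun j : 'I_N => q ^+ j)) prodr_const card_ord.
apply: lerXn2r; rewrite ?nnegrE ?invr_ge0 ?(ltW q1')//.
  by apply: sumr_ge0 => j _; rewrite exprn_ge0// ltW.
rewrite -[leRHS]mul1r ler_pdivlMr// mulrC -opprB mulNr -subrX1 opprB.
by rewrite gerBl exprn_ge0// ltW.
Qed.

End GeometricBox.

Section Decay.
Variables (R : realType) (q : R) (n : nat) (phi : R).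
Hypothesis hq : 0 < q < 1.
Variables (V : hilbertType R) (e : {ffun 'I_n -> nat} -> V).
Hypothesis he : orthonormal_basis e.
Variables pi_p pi_m : A2n q n -> V -> V.
Hypotheses (hp : is_pi_phi phi e false pi_p) (hm : is_pi_phi phi e true pi_m).
Local Notation index := {ffun 'I_n -> nat}.
Implicit Types (x y : A2n q n) (k j : index) (l : 'I_n).
Local Notation Q := (q%:C%C).

Let q0 : 0 < q. Proof. by case/andP: hq. Qed.
Let Q0 : 0 < Q. Proof. by rewrite ltcR. Qed.
Let Q1 : Q <= 1. Proof. by rewrite -[1]/(1%:C%C) lecR ltW//; case/andP: hq. Qed.
Let srp : star_representation pi_p. Proof. by case: hp. Qed.
Let srm : star_representation pi_m. Proof. by case: hm. Qed.

Definition decay x := exists2 C : R[i], 0 <= C & forall k,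
  `|pi_p x (e k) - pi_m x (e k)| <= C * Q ^+ weight k.

(** [decay] alone does not obviously pass from [x] and [y] to [x * y], because
    [pi_m y (e k)] is not a basis vector; this property does pass to products,
    and it gives back [decay] when applied to [x = 1]. *)
Definition decay_multiplier y := forall x, decay x -> decay (x * y).

Lemma rep_lin (rho : A2n q n -> V -> V) : star_representation rho ->
  [/\ forall x y v, rho (x + y) v = rho x v + rho y v,
      forall (a : R[i]) x v, rho (a *: x) v = a *: rho x v
    & forall v, rho 0 v = 0].
Proof.
case=> _ lr _ _ _.
have r0 v : rho 0 v = 0.
  by apply: (addrI (rho 0 v)); have := lr 1 0 0 v; rewrite !scale1r !addr0.
split => //.
  by move=> x y v; have := lr 1 x y v; rewrite !scale1r.
by move=> a x v; have := lr a x 0 v; rewrite r0 !addr0.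
Qed.

Lemma decay1 : decay 1.
Proof.
have [_ _ p1 _ _] := srp; have [_ _ m1 _ _] := srm.
by exists 0 => // k; rewrite p1 m1 subrr normr0 mul0r.
Qed.

Lemma decayD x y : decay x -> decay y -> decay (x + y).
Proof.
have [pD _ _] := rep_lin srp; have [mD _ _] := rep_lin srm.
move=> [C C0 xC] [D D0 yD]; exists (C + D); first exact: addr_ge0.
move=> k; rewrite pD mD opprD addrACA (le_trans (ler_normD _ _))// mulrDl.
by rewrite lerD.
Qed.

Lemma decayZ a x : decay x -> decay (a *: x).
Proof.
have [_ pZ _] := rep_lin srp; have [_ mZ _] := rep_lin srm.
move=> [C C0 xC]; exists (`|a| * C); first exact: mulr_ge0.
by move=> k; rewrite pZ mZ -scalerBr normrZ -mulrA ler_wpM2l.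
Qed.

Lemma decay_multiplier1 : decay_multiplier 1.
Proof. by move=> x; rewrite mulr1. Qed.

Lemma decay_multiplierD y z :
  decay_multiplier y -> decay_multiplier z -> decay_multiplier (y + z).
Proof.
by move=> hy hz x dx; rewrite mulrDr; apply: decayD; [exact: hy|exact: hz].
Qed.

Lemma decay_multiplierZ a y : decay_multiplier y -> decay_multiplier (a *: y).
Proof. by move=> hy x dx; rewrite -scalerAr; apply/decayZ/hy. Qed.

Lemma decay_multiplierM y z :
  decay_multiplier y -> decay_multiplier z -> decay_multiplier (y * z).
Proof. by move=> hy hz x dx; rewrite mulrA; apply/hz/hy. Qed.

(** The common value [c k *: e (f k)] can be pulled out of
    [pi_p (x * y) (e k) - pi_m (x * y) (e k)]; lowering the weight by one only
    costs a factor [q^-1]. *)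
Lemma shift_multiplier y (f : index -> index) (c : index -> R[i]) :
  (forall k, pi_p y (e k) = c k *: e (f k)) ->
  (forall k, pi_m y (e k) = c k *: e (f k)) ->
  (forall k, (weight k <= (weight (f k)).+1)%N) -> decay_multiplier y.
Proof.
move=> py my wf x [C C0 xC].
have [bp _ _ pM _] := srp; have [bm _ _ mM _] := srm.
have [M M0 yM] := bounded_operator_ge0 (bp y).
exists (M * (C / Q)) => [|k].
  by rewrite mulr_ge0// divr_ge0// ltW.
have cM : `|c k| <= M.
  have := yM (e k); rewrite py normrZ.
  by rewrite !(orthonormal_norm he) !mulr1.
rewrite pM mM py my (linear_opZ (bp x).1) (linear_opZ (bm x).1) -scalerBr normrZ.
rewrite -!mulrA ler_pM// (le_trans (xC _))// ler_wpM2l// mulrC ler_pdivlMr//.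
by rewrite -exprSr ler_wiXn2l// ltW.
Qed.

(** Here the signs differ, but [zeta_n] itself supplies the factor
    [q ^ |k|], so that the boundedness of [pi_p x] and [pi_m x] suffices. *)
Lemma zeta_last_multiplier : decay_multiplier (zeta q ord_max).
Proof.
move=> x _.
have [bp _ _ pM _] := srp; have [bm _ _ mM _] := srm.
have [_ pz _ _] := hp; have [_ mz _ _] := hm.
have [M M0 xM] := bounded_operator_ge0 (bp x).
have [N N0 xN] := bounded_operator_ge0 (bm x).
exists (`|expi phi| * (M + N)) => [|k]; first by rewrite mulr_ge0// addr_ge0.
rewrite pM mM pz mz (linear_opZ (bp x).1) (linear_opZ (bm x).1).
rewrite expr0 expr1 mul1r mulN1r mulNr scaleNr opprK -scalerDr normrZ normrM.
rewrite -mulrA -[X in _ <= X]mulrA ler_wpM2l// mulrC ler_pM//.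
  rewrite (le_trans (ler_normD _ _))// lerD//.
    by rewrite (le_trans (xM _))// (orthonormal_norm he) mulr1.
  by rewrite (le_trans (xN _))// (orthonormal_norm he) mulr1.
rewrite normr_real_complex ger0_norm ?exprn_ge0 ?(ltW q0)// rmorphXn/=.
by rewrite exprD -/(weight k) ger_pMr ?exprn_gt0// exprn_ile1// ltW.
Qed.

Definition raise l k : index := [ffun i => if i == l then (k i).+1 else k i].

Lemma weight_lower l k : (weight k <= (weight (lower l k)).+1)%N.
Proof.
rewrite /weight (bigD1 l)// [in X in (_ <= X)%N](bigD1 l)//= ffunE eqxx.
rewrite -addSn leq_add ?leqSpred//; apply: leq_sum => i il.
by rewrite ffunE (negPf il).
Qed.

Lemma weight_raise l k : (weight k <= (weight (raise l k)).+1)%N.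
Proof.
apply: leqW; apply: leq_sum => i _; rewrite ffunE; case: ifP => // _.
Qed.

Lemma lower_raise l k j : j l != 0%N -> (k == lower l j) = (raise l k == j).
Proof.
move=> jl; apply/eqP/eqP => [->|<-]; apply/ffunP => i; rewrite !ffunE.
  by case: eqP => // ->; rewrite prednK// lt0n.
by case: eqP.
Qed.

Definition zeta_coef l k : R[i] := (Num.sqrt (1 - q ^+ (2 * k l)) *
  q ^+ (\sum_(i < n | (i < l)%N) k i + l))%:C%C.

Lemma rep_star (rho : A2n q n -> V -> V) y : star_representation rho ->
  adjoint_to (rho (star y)) (rho y).
Proof. by case=> _ _ _ _ rA; apply: adjoint_sym. Qed.

(** The adjoint is tested against every [e j].  When [j l = 0] the vector
    [lower l j = j] is a default value, and the coefficient vanishes. *)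
Lemma zeta_star_basis s (rho : A2n q n -> V -> V) l k : is_pi_phi phi e s rho ->
  rho (star (zeta q (widen_ord (leqnSn n) l))) (e k) =
  (zeta_coef l (raise l k))^* *: e (raise l k).
Proof.
case=> sr _ rz _; apply/eqP; rewrite -subr_eq0; apply/eqP.
apply: (orthonormal_basis_inj he) => j.
rewrite dotBl dotZl (rep_star _ sr) rz dotZr -/(zeta_coef l j) !he.1.
have [jl|jl] := eqVneq (j l) 0%N.
  have -> : zeta_coef l j = 0.
    by rewrite /zeta_coef jl muln0 expr0 subrr sqrtr0 mul0r.
  have /negPf -> : raise l k != j.
    by apply/eqP => /ffunP/(_ l); rewrite ffunE eqxx jl.
  by rewrite conjC0 mul0r mulr0 subrr.
rewrite lower_raise//; case: eqP => [->|_]; first by rewrite subrr.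
by rewrite !mulr0 subrr.
Qed.

Lemma zeta_multiplier l : decay_multiplier (zeta q (widen_ord (leqnSn n) l)).
Proof.
have [_ _ pz _] := hp; have [_ _ mz _] := hm.
apply: (@shift_multiplier _ (lower l) (zeta_coef l)) => k.
- exact: pz.
- exact: mz.
- exact: weight_lower.
Qed.

Lemma zeta_star_multiplier l :
  decay_multiplier (star (zeta q (widen_ord (leqnSn n) l))).
Proof.
apply: (@shift_multiplier _ (raise l) (fun k => (zeta_coef l (raise l k))^*)) => k.
- exact: (zeta_star_basis _ _ hp).
- exact: (zeta_star_basis _ _ hm).
- exact: weight_raise.
Qed.

Lemma xi_multiplier : decay_multiplier (xi q n).
Proof.
have [_ _ _ px] := hp; have [_ _ _ mx] := hm.
exact: (@shift_multiplier _ id (fun=> expi (- (2 * phi)))).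
Qed.

Lemma xi_star_mul : star (xi q n) * xi q n = 1.
Proof.
rewrite /star /= /xi A2n_starE [LHS]A2n_mulE; apply/A2n_eqP.
exact: rel_xi_unitaryl.
Qed.

(** [xi] acts on [e k] by a scalar, nonzero since [star xi * xi = 1]. *)
Lemma xi_star_basis s (rho : A2n q n -> V -> V) k : is_pi_phi phi e s rho ->
  rho (star (xi q n)) (e k) = (expi (- (2 * phi)))^-1 *: e k.
Proof.
case=> -[br _ r1 rM _] _ _ rx.
have E : expi (- (2 * phi)) *: rho (star (xi q n)) (e k) = e k.
  by rewrite -(linear_opZ (br _).1) -rx -rM xi_star_mul r1.
rewrite -[in RHS]E scalerA mulVf ?scale1r//.
apply/eqP => u0; have := orthonormal_norm he k.
by rewrite -E u0 scale0r normr0 => /esym/eqP; rewrite oner_eq0.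
Qed.

Lemma xi_star_multiplier : decay_multiplier (star (xi q n)).
Proof.
apply: (@shift_multiplier _ id (fun=> (expi (- (2 * phi)))^-1)) => k //.
- exact: (xi_star_basis _ hp).
- exact: (xi_star_basis _ hm).
Qed.

Lemma zeta_last_star : star (zeta q ord_max) = zeta q ord_max * xi q n.
Proof.
rewrite /star /= /xi /zeta A2n_starE [RHS]A2n_mulE; apply/A2n_eqP.
exact: rel_zeta_last.
Qed.

Definition decay_star_multiplier y :=
  decay_multiplier y /\ decay_multiplier (star y).

Lemma zetaP (P : A2n q n -> Prop) : P (zeta q ord_max) ->
  (forall l, P (zeta q (widen_ord (leqnSn n) l))) -> forall i, P (zeta q i).
Proof.
move=> Pn Pl i; have [il|ni] := ltnP i n.
  have -> : i = widen_ord (leqnSn n) (Ordinal il) by apply/val_inj.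
  exact: Pl.
have -> : i = ord_max by apply/val_inj/eqP; rewrite eqn_leq ni -ltnS ltn_ord.
exact: Pn.
Qed.

Lemma decay_star_multiplier1 : decay_star_multiplier 1.
Proof.
have s1 : star 1 = 1 :> A2n q n.
  by rewrite -[LHS]mulr1 -{2}[1](starK (1 : A2n q n)) -starM mulr1 starK.
by split; rewrite ?s1; exact: decay_multiplier1.
Qed.

Lemma decay_star_multiplierD y z : decay_star_multiplier y ->
  decay_star_multiplier z -> decay_star_multiplier (y + z).
Proof.
by move=> [y1 y2] [z1 z2]; split; rewrite ?starD; exact: decay_multiplierD.
Qed.

Lemma decay_star_multiplierZ a y : decay_star_multiplier y ->
  decay_star_multiplier (a *: y).
Proof.
by move=> [y1 y2]; split; rewrite ?starZ; exact: decay_multiplierZ.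
Qed.

Lemma decay_star_multiplierM y z : decay_star_multiplier y ->
  decay_star_multiplier z -> decay_star_multiplier (y * z).
Proof.
by move=> [y1 y2] [z1 z2]; split; rewrite ?starM; exact: decay_multiplierM.
Qed.

Lemma decay_star_multiplier_star y : decay_star_multiplier y ->
  decay_star_multiplier (star y).
Proof. by move=> [y1 y2]; split; rewrite ?starK. Qed.

(** Closing under [star] at the same time makes the induction on expressions
    in the generators go through. *)
Lemma decay_star_multiplier_all y : decay_star_multiplier y.
Proof.
elim/quotW: y; elim.
- apply: (@zetaP decay_star_multiplier).
    split; first exact: zeta_last_multiplier.
    rewrite zeta_last_star; apply: decay_multiplierM.
      exact: zeta_last_multiplier.
    exact: xi_multiplier.
  by move=> l; split; [exact: zeta_multiplier|exact: zeta_star_multiplier].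
- by split; [exact: xi_multiplier|exact: xi_star_multiplier].
- by have := decay_star_multiplierZ 0 decay_star_multiplier1; rewrite scale0r.
- exact: decay_star_multiplier1.
- by move=> x hx y hy; rewrite -A2n_addE; exact: decay_star_multiplierD.
- move=> x hx; rewrite -A2n_oppE.
  by have := decay_star_multiplierZ (-1) hx; rewrite scaleN1r.
- by move=> x hx y hy; rewrite -A2n_mulE; exact: decay_star_multiplierM.
- by move=> a x hx; rewrite -A2n_scaleE; exact: decay_star_multiplierZ.
- by move=> x hx; rewrite -A2n_starE; exact: decay_star_multiplier_star.
Qed.

Lemma decay_all x : decay x.
Proof.
by rewrite -[x]mul1r; apply: (decay_star_multiplier_all x).1; exact: decay1.
Qed.

Lemma pi_difference_summable x :
  basis_summable e (fun v => pi_p x v - pi_m x v).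
Proof.
have [C C0 xC] := decay_all x.
exists (complex.Re C * (1 - q)^-1 ^+ n) => s us.
rewrite rmorphM/= RRe_real ?ger0_real//.
apply: (@le_trans _ _ (\sum_(k <- s) C * Q ^+ weight k)).
  by apply: ler_sum => k _.
rewrite -mulr_sumr ler_wpM2l//.
under eq_bigr do rewrite -rmorphXn/=.
by rewrite -rmorph_sum lecR sum_expr_weight.
Qed.

End Decay.

Theorem mainTheorem10 (R : realType) (q : R) (hq : 0 < q < 1)
    (n : nat) (hn : (1 < n)%N) (phi : R) (hphi : 0 < phi < 2 * pi)
    (V : hilbertType R) (e : {ffun 'I_n -> nat} -> V)
    (he : orthonormal_basis e)
    (pi_p pi_m : A2n q n -> V -> V)
    (hp : is_pi_phi phi e false pi_p) (hm : is_pi_phi phi e true pi_m) :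
  even_fredholm_module (direct_sum_rep pi_p pi_m) (@flip_op R V)
    (@grading_op R V) /\
  one_summable (direct_sum_rep pi_p pi_m) (@flip_op R V).
Proof.
have [sp _ _ _] := hp; have [sm _ _ _] := hm.
apply: (summable_difference_fredholm sp sm he) => x.
exact: (pi_difference_summable hq he hp hm).
Qed.
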